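(* Let the treatment be binary, $A\in\mathcal{A}=\{0,1\}$. Assume: (consistency) $Y=Y(A)$; (latent ignorability) for any $a\in\mathcal{A}$, $Y(a)$ is conditionally independent of $\{A,Z\}$ given $(U,L)$; (IV independence) $Z$ is conditionally independent of $U$ given $L$; (IV relevance) for any $a\in\mathcal{A}$ and $l\in\mathcal{L}$, $Z$ and $I\{A=a\}$ are not conditionally independent given $L=l$, i.e. there exist two distinct $z_0,z_1\in\mathcal{Z}$ with $\Pr(A=a\mid Z=z_0,L=l)\neq\Pr(A=a\mid Z=z_1,L=l)$; and $$\mathrm{Cov}\{Y(1)-Y(0),\ \mathbb{E}[A\mid Z=z,U,L]-\mathbb{E}[A\mid U,L]\mid L\}=0\quad\text{for any }z\in\mathcal{Z}.$$ Then the equation $\mathbb{E}[Y\mid Z,L]=\mathbb{E}[f^o(A,L)\mid Z,L]$ has a unique solution $f^o(A,L)$, namely $$f^o(0,L)=\mathrm{Cov}\{\mathbb{E}[Y(1)-Y(0)\mid U,L],\Pr(A=1\mid U,L)\mid L\}+\mathbb{E}[Y(0)\mid L],$$ $$f^o(1,L)=\mathrm{Cov}\{\mathbb{E}[Y(1)-Y(0)\mid U,L],\Pr(A=1\mid U,L)\mid L\}+\mathbb{E}[Y(1)\mid L].$$ Furthermore, for any regular weighting function $\pi(Z,L)$ for $A$, $$\mathbb{E}[Y(1)-Y(0)]=\psi_\pi^o:=\mathbb{E}\left[\frac{\mathrm{Cov}\{Y,\pi(Z,L)\mid L\}}{\mathrm{Cov}\{A,\pi(Z,L)\mid L\}}\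right].$$
   Context: $Z\in\mathcal{Z}\subseteq\mathbb{R}^{d_Z}$ is an instrument (multi-categorical or continuous), $U$ unmeasured confounders, $L\in\mathcal{L}\subseteq\mathbb{R}^{d_L}$ observed covariates, $Y\in\mathbb{R}$ the observed outcome, $Y(a)$ the potential outcome at treatment level $a$. For binary $A$, $\pi(Z,L)$ is a regular weighting function for $A$ if it is uniformly bounded and there exists $\epsilon_0>0$ with $|\mathrm{Cov}\{A,\pi(Z,L)\mid L\}|\ge\epsilon_0$ uniformly for all $L$. Equalities between random variables are almost sure; the moments involved are assumed to exist. *)

(* Defs.v *)
From HB Require Import structures.
From mathcomp Require Import all_boot all_order all_algebra.
From mathcomp Require Import all_classical all_reals all_analysis.
From mathcomp Require Import measurable_realfun.

Set Implicit Arguments.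
Unset Strict Implicit.
Unset Printing Implicit Defensive.
Import Order.TTheory GRing.Theory Num.Theory.
Import numFieldNormedType.Exports.
Local Open Scope classical_set_scope.
Local Open Scope ring_scope.

(* [is_condE P X V g]: the Borel function g is a version of the regression
   function x |-> E[V | X = x]; by Doob-Dynkin, E[V | X] is the random variable
   g(X).  The existence of the first moment of V is part of the predicate. *)
Definition is_condE d dT (Omega : measurableType d) (T : measurableType dT)
    (R : realType) (P : probability Omega R)
    (X : Omega -> T) (V : Omega -> R) (g : T -> R) : Prop :=
  [/\ measurable_fun setT g,
      P.-integrable setT (EFin \o V),
      P.-integrable setT (EFin \o (g \o X)) &
      forall B, measurable B ->
        (\int[P]_(w in X @^-1` B) (V w)%:E =
         \int[P]_(w in X @^-1` B) (g (X w))%:E)%E].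

(* Cov{V, W | X} = E[V W | X] - E[V | X] E[W | X]; the moments involved are
   required to exist. *)
Definition is_condCov d dT (Omega : measurableType d) (T : measurableType dT)
    (R : realType) (P : probability Omega R)
    (X : Omega -> T) (V W : Omega -> R) (c : T -> R) : Prop :=
  measurable_fun setT c /\
  exists eV eW eVW : T -> R,
    [/\ is_condE P X V eV, is_condE P X W eW, is_condE P X (V \* W) eVW &
        {ae P, forall w, c (X w) = eVW (X w) - eV (X w) * eW (X w)}].

(* V and W are conditionally independent given X:
   Pr(V in B, W in C | X) = Pr(V in B | X) Pr(W in C | X) almost surely. *)
Definition cond_indep d d1 d2 dT (Omega : measurableType d)
    (T1 : measurableType d1) (T2 : measurableType d2) (T : measurableType dT)
    (R : realType) (P : probability Omega R)
    (V : Omega -> T1) (W : Omega -> T2) (X : Omega -> T) : Prop :=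
  forall B C, measurable B -> measurable C ->
    exists pB pC : T -> R,
      [/\ is_condE P X (\1_(V @^-1` B)) pB,
          is_condE P X (\1_(W @^-1` C)) pC &
          is_condE P X (\1_(V @^-1` B `&` W @^-1` C)) (pB \* pC)].

Definition indep d d1 d2 (Omega : measurableType d)
    (T1 : measurableType d1) (T2 : measurableType d2)
    (R : realType) (P : set Omega -> \bar R)
    (V : Omega -> T1) (W : Omega -> T2) : Prop :=
  forall B C, measurable B -> measurable C ->
    (P (V @^-1` B `&` W @^-1` C) = P (V @^-1` B) * P (W @^-1` C))%E.

(* The kernel k is a regular conditional distribution of V given X; k l is the
   law of V given X = l. *)
Definition is_cond_law d d1 dT (Omega : measurableType d)
    (T1 : measurableType d1) (T : measurableType dT)
    (R : realType) (P : probability Omega R)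
    (X : Omega -> T) (V : Omega -> T1) (k : R.-pker T ~> T1) : Prop :=
  forall B C, measurable B -> measurable C ->
    P (X @^-1` B `&` V @^-1` C) = (\int[P]_(w in X @^-1` B) k (X w) C)%E.

(* [k l] is the law of (Z, A) given L = l.  Dependence of Z and I{A = a} given
   L = l does not refer to a version of z |-> Pr(A = a | Z = z, L = l);
   by [iv_relevanceP] below, it means that each such version takes different
   values at two points z0, z1 of any set that carries Z given L = l. *)
Definition iv_relevance dZ dL (TZ : measurableType dZ) (TL : measurableType dL)
    (R : realType) (calL : set TL) (k : R.-pker TL ~> (TZ * bool)%type) : Prop :=
  forall (a : bool) l, calL l ->
    ~ indep (k l) fst (fun x : TZ * bool => x.2 == a).

(* Z is multi-categorical (nu the counting measure on the categories) or
   continuous (nu the Lebesgue measure): given L = l, it has a density with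
   respect to a common sigma-finite nu. *)
Definition cond_dominated dZ dL (TZ : measurableType dZ)
    (TL : measurableType dL) (R : realType) (calL : set TL)
    (k : R.-pker TL ~> (TZ * bool)%type) : Prop :=
  exists nu : {sigma_finite_measure set TZ -> \bar R},
    forall l, calL l -> forall B, measurable B -> nu B = 0%E ->
      k l (B `*` setT) = 0%E.

(* f solves E[Y | Z, L] = E[f(A, L) | Z, L]. *)
Definition solves d dZ dL (Omega : measurableType d)
    (TZ : measurableType dZ) (TL : measurableType dL)
    (R : realType) (P : probability Omega R)
    (A : Omega -> bool) (Z : Omega -> TZ) (L : Omega -> TL) (Y : Omega -> R)
    (f : bool -> TL -> R) : Prop :=
  (forall a, measurable_fun setT (f a)) /\
  exists g : TZ * TL -> R,
    is_condE P (fun w => (Z w, L w)) Y g /\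
    is_condE P (fun w => (Z w, L w)) (fun w => f (A w) (L w)) g.

Definition regular_weight d dZ dL (Omega : measurableType d)
    (TZ : measurableType dZ) (TL : measurableType dL)
    (R : realType) (P : probability Omega R)
    (calZ : set TZ) (calL : set TL)
    (A : Omega -> bool) (Z : Omega -> TZ) (L : Omega -> TL)
    (pi : TZ -> TL -> R) : Prop :=
  [/\ measurable_fun setT (fun x : TZ * TL => pi x.1 x.2),
      exists M : R, forall z l, calZ z -> calL l -> `|pi z l| <= M &
      exists (eps0 : R) (c : TL -> R),
        [/\ 0 < eps0,
            is_condCov P L (fun w => (A w)%:R) (fun w => pi (Z w) (L w)) c &
            {ae P, forall w, eps0 <= `|c (L w)|}]].

Lemma iv_relevanceP dZ (TZ : measurableType dZ) (R : realType)
    (mu : probability (TZ * bool)%type R) (a : bool) (D : set TZ) :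
  measurable D -> mu (D `*` setT) = 1%E ->
  ~ indep mu fst (fun x : TZ * bool => x.2 == a) <->
  forall p : TZ -> R,
    is_condE mu fst (fun x : TZ * bool => (x.2 == a)%:R) p ->
    exists z0 z1, [/\ D z0, D z1 & p z0 <> p z1].
Proof.
move=> mD D1; set f := fun x : TZ * bool => x.2 == a.
pose E := f @^-1` [set true].
have mf : measurable_fun setT f.
  by apply: (measurableT_comp (f := fun b : bool => b == a)).
have mpre (B : set TZ) : measurable B ->
    measurable ((@fst TZ bool) @^-1` B).
  by move=> mB; rewrite -[X in measurable X]setTI; exact: measurable_fst.
have mE : measurable E by rewrite -[X in measurable X]setTI; exact: mf.
have fE x : (f x)%:R = \1_E x :> R.
  rewrite indicE; congr (_%:R); rewrite /E; case fx: (f x).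
    by rewrite mem_set.
  by rewrite memNset//= fx.
have intE (B : set TZ) : measurable B ->
    (\int[mu]_(x in fst @^-1` B) ((f x)%:R)%:E = mu (fst @^-1` B `&` E))%E.
  move=> mB; rewrite setIC -integral_indic//; last exact: mpre.
  by apply: eq_integral => x _; rewrite fE.
split=> [nindep p [mp _ _ Hp]|H ind]; last first.
  have muE : mu E = (fine (mu E))%:E by rewrite fineK// fin_num_measure.
  have [|z0 [z1 [_ _ []//]]] := H (cst (fine (mu E))).
  split.
  - exact: measurable_cst.
  - under eq_fun do rewrite /= -/(f _) fE.
    exact: integrable_indic.
  - by apply: finite_measure_integrable_cst.
  - move=> B mB; rewrite -/f intE//.
    have /= -> := integral_cst mu (mpre _ mB) (fine (mu E))%:E.
    by rewrite -muE muleC; apply: ind => //.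
apply: contrapT => nz; apply: nindep.
have [z Dz] : exists z, D z.
  apply/set0P/eqP => D0; move: D1; rewrite D0 set0X measure0 => /eqP.
  by rewrite eq_sym onee_eq0.
have pD y : D y -> p y = p z.
  by move=> Dy; apply: contrapT => pyz; apply: nz; exists y, z.
have mDT : measurable (D `*` [set: bool]) by exact: measurableX.
have nD : mu (~` (D `*` [set: bool])) = 0%E.
  by rewrite probability_setC// D1 subee.
have aeD : {ae mu, forall x, p x.1 = p z}.
  exists (~` (D `*` setT)); split => //; first exact: measurableC.
  by move=> x /= npx Dx; apply: npx; apply: pD; case: Dx.
have key B : measurable B -> mu (fst @^-1` B `&` E) = ((p z)%:E * mu (fst @^-1` B))%E.
  move=> mB; rewrite -intE// Hp//.
  have /= <- := integral_cst mu (mpre _ mB) (p z)%:E.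
  apply: ae_eq_integral => //; try exact: mpre.
  - apply: (@measurable_funS _ _ _ _ setT) => //; apply/measurable_EFinP.
    exact: measurableT_comp.
  - by apply: filterS aeD => x -> _.
have muE : mu E = (p z)%:E.
  have := key setT measurableT; rewrite preimage_setT setTI => ->.
  by rewrite probability_setT mule1.
have indE B : measurable B ->
    mu (fst @^-1` B `&` E) = (mu (fst @^-1` B) * mu E)%E.
  by move=> mB; rewrite key// muE muleC.
have EC : f @^-1` [set false] = ~` E.
  apply/seteqP; split => x; rewrite /E/=; first by move=> ->.
  by move=> /negP/negbTE.
move=> B C mB _.
have [/eqP->|/eqP->|/eqP->|/eqP->] := set_bool C; rewrite ?EC.
- exact: indE.
- have mX := mpre _ mB.
  rewrite -setDE (measureD mX mE); last by rewrite -ge0_fin_numE// fin_num_measure.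
  rewrite [X in (_ - X)%E](indE _ mB) [in RHS](probability_setC mu mE) muleBr ?mule1//.
    by rewrite fin_num_measure.
- by rewrite !preimage_set0 setI0 measure0 mule0.
- by rewrite !preimage_setT setIT probability_setT mule1.
Qed.

(* Main.v *)
(* Write D = Y(1) - Y(0), b(L) = E[D | L] and delta(U, L) = E[D | U, L].  By
   consistency and latent ignorability E[Y | Z, U, L] = E[Y(0) | U, L] +
   E[A | Z, U, L] delta(U, L), and averaging over U, which is independent of Z
   given L, turns the first term into E[Y(0) | L].  The assumption of no
   correlation says that for each z the deviation E[A | Z = z, U, L] - E[A | U, L]
   has the same conditional mean given L whether it is weighted by delta(U, L) or
   by b(L).  Hence E[Y | Z, L] = E[Y(0) | L] + Cov{delta, E[A | U, L] | L}
   + b(L) E[A | Z, L], which is E[f(A, L) | Z, L] for the announced f.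

   The assumption holds for each z outside a null set depending on z.  It passes
   to the random Z because the law of (Z, U, L) has a density rho(z, l) with
   respect to the product of a sigma-finite nu and the law of (U, L), so that
   Fubini's theorem applies.

   If h(A, L) is the difference of two solutions, then
   h(0, L) + (h(1, L) - h(0, L)) E[A | Z, L] = 0; where h(1, L) <> h(0, L), the
   regression E[A | Z, L] depends on L only, so that A and Z are independent given
   L, against relevance.  Finally, taking conditional covariances with pi(Z, L) in
   the equation for Y gives Cov{Y, pi | L} = b(L) Cov{A, pi | L}, and
   E[b(L)] = E[D]. *)
From HB Require Import structures.
Require Import Defs.
From mathcomp Require Import all_boot all_order all_algebra.
From mathcomp Require Import all_classical all_reals all_analysis.
From mathcomp Require Import measurable_realfun ring.
Import Order.TTheory GRing.Theory Num.Theory.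
Import numFieldNormedType.Exports.
Local Open Scope classical_set_scope.
Local Open Scope ring_scope.

Set Implicit Arguments.
Unset Strict Implicit.
Unset Printing Implicit Defensive.

(** * Transfer of integrals *)

Lemma measurable_preimage d1 d2 (T1 : measurableType d1) (T2 : measurableType d2)
    (f : T1 -> T2) (B : set T2) :
  measurable_fun setT f -> measurable B -> measurable (f @^-1` B).
Proof. by move=> mf mB; rewrite -[X in measurable X]setTI; exact: mf. Qed.

Section transfer.
Local Open Scope ereal_scope.
Import HBNNSimple.

(** Monotone convergence along simple approximations of [phi]. The right-hand side sees [X] and [G]
    only through the integrals of [G] over preimages under [X], so that two such pairs can be
    compared term by term. *)
Lemma ge0_integral_comp_lim d d' (T : measurableType d) (S : measurableType d')
    (R : realType) (mu : {measure set T -> \bar R}) (X : T -> S)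
    (G : T -> R) (phi : S -> R)
    (mphi : measurable_fun setT (EFin \o phi)) :
  measurable_fun setT X -> measurable_fun setT G ->
  (forall x, (0 <= G x)%R) -> (forall y, (0 <= phi y)%R) ->
  \int[mu]_x (phi (X x) * G x)%:E = limn (fun n =>
    \sum_(r \in range (nnsfun_approx measurableT mphi n)) (r%:E *
      \int[mu]_(x in X @^-1` (nnsfun_approx measurableT mphi n @^-1` [set r]))
        (G x)%:E)).
Proof.
move=> mX mG G0 phi0; set phi_ := nnsfun_approx measurableT mphi.
have mphi_ n : measurable_fun setT (fun x => phi_ n (X x)).
  exact: measurableT_comp.
transitivity (\int[mu]_x limn (fun n => (phi_ n (X x))%:E * (G x)%:E)).
  apply: eq_integral => x _; apply/esym/cvg_lim => //.
  rewrite EFinM; apply: cvgeZr => //.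
  apply: (@cvg_nnsfun_approx _ _ _ _ measurableT _ mphi) => //.
  by move=> y _; rewrite lee_fin phi0.
rewrite monotone_convergence//; last 3 first.
- by move=> n; apply: emeasurable_funM; exact/measurable_EFinP.
- by move=> n x _; rewrite -EFinM lee_fin mulr_ge0.
- move=> x _ m n mn; apply: lee_wpmul2r; first by rewrite lee_fin.
  by rewrite lee_fin; exact/lefP/nd_nnsfun_approx.
congr (limn _); apply/funext => n.
have mpre r : measurable (X @^-1` (phi_ n @^-1` [set r])).
  by apply: measurable_preimage => //; exact: measurable_preimage.
have mGr r : measurable_fun setT
    ((EFin \o G) \_ (X @^-1` (phi_ n @^-1` [set r]))).
  apply/(measurable_restrictT _ _).1 => //; apply: measurable_funTS.
  exact/measurable_EFinP.
transitivity (\int[mu]_x (\sum_(r \in range (phi_ n))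
    (r%:E * ((EFin \o G) \_ (X @^-1` (phi_ n @^-1` [set r]))) x))).
  apply: eq_integral => x _; rewrite (fimfunE (phi_ n) (X x)) -fsumEFin//.
  rewrite ge0_mule_fsuml; last first.
    by move=> r; rewrite EFinM nnfun_muleindic_ge0.
  apply: eq_fsbigr => r _; rewrite EFinM -muleA patchE indicE.
  rewrite (_ : (x \in X @^-1` _) = (X x \in phi_ n @^-1` [set r])); last first.
    by apply/idP/idP; rewrite !inE.
  by case: ifPn => xr; rewrite ?mul1e ?mul0e.
rewrite ge0_integral_fsum//.
- apply: eq_fsbigr => r _; have [r0|r0] := leP 0%R r.
    rewrite ge0_integralZl//; first by rewrite [in RHS]integral_mkcond.
    by move=> x _; rewrite patchE; case: ifP; rewrite ?lee_fin.
  rewrite preimage_nnfun0// preimage_set0 integral_set0 mule0.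
  by rewrite patch_set0; under eq_integral do rewrite /= mule0; exact: integral0.
- move=> r; exact/measurable_funeM/mGr.
- move=> r x _; have [r0|r0] := leP 0%R r; last first.
    by rewrite preimage_nnfun0// preimage_set0 patch_set0 mule0.
  by rewrite mule_ge0 ?lee_fin// patchE; case: ifP; rewrite ?lee_fin.
Qed.

Lemma ge0_integral_comp_eq d1 d2 d' (T1 : measurableType d1)
    (T2 : measurableType d2) (S : measurableType d') (R : realType)
    (mu1 : {measure set T1 -> \bar R}) (mu2 : {measure set T2 -> \bar R})
    (X1 : T1 -> S) (X2 : T2 -> S) (G1 : T1 -> R) (G2 : T2 -> R) (phi : S -> R) :
  measurable_fun setT X1 -> measurable_fun setT X2 ->
  measurable_fun setT G1 -> measurable_fun setT G2 ->
  (forall x, (0 <= G1 x)%R) -> (forall x, (0 <= G2 x)%R) ->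
  (forall B, measurable B -> \int[mu1]_(x in X1 @^-1` B) (G1 x)%:E =
                             \int[mu2]_(x in X2 @^-1` B) (G2 x)%:E) ->
  measurable_fun setT phi -> (forall y, (0 <= phi y)%R) ->
  \int[mu1]_x (phi (X1 x) * G1 x)%:E = \int[mu2]_x (phi (X2 x) * G2 x)%:E.
Proof.
move=> mX1 mX2 mG1 mG2 G10 G20 G12 /measurable_EFinP mphi phi0.
rewrite (ge0_integral_comp_lim _ mphi)// (ge0_integral_comp_lim _ mphi)//.
by congr (limn _); apply/funext => n; apply: eq_fsbigr => r _; rewrite G12.
Qed.

End transfer.

(** The hypothesis on preimages says that the measures with densities [G1] and [G2] have the same
    image on [S]. Integrability passes across through the absolute value of [phi], and the integral
    through its positive and negative parts. *)
Lemma integral_comp_eq d1 d2 d' (T1 : measurableType d1)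
    (T2 : measurableType d2) (S : measurableType d') (R : realType)
    (mu1 : {measure set T1 -> \bar R}) (mu2 : {measure set T2 -> \bar R})
    (X1 : T1 -> S) (X2 : T2 -> S) (G1 : T1 -> R) (G2 : T2 -> R) (phi : S -> R) :
  measurable_fun setT X1 -> measurable_fun setT X2 ->
  measurable_fun setT G1 -> measurable_fun setT G2 ->
  (forall x, 0 <= G1 x) -> (forall x, 0 <= G2 x) ->
  (forall B, measurable B -> (\int[mu1]_(x in X1 @^-1` B) (G1 x)%:E =
                             \int[mu2]_(x in X2 @^-1` B) (G2 x)%:E)%E) ->
  measurable_fun setT phi ->
  mu1.-integrable setT (EFin \o (fun x => phi (X1 x) * G1 x)) ->
  mu2.-integrable setT (EFin \o (fun x => phi (X2 x) * G2 x)) /\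
  (\int[mu1]_x (phi (X1 x) * G1 x)%:E = \int[mu2]_x (phi (X2 x) * G2 x)%:E)%E.
Proof.
move=> mX1 mX2 mG1 mG2 G10 G20 G12 mphi /integrableP[_ fin1].
have K psi := @ge0_integral_comp_eq _ _ _ _ _ _ _ _ _ _ _ _ _ psi mX1 mX2 mG1
  mG2 G10 G20 G12.
split.
  apply/integrableP; split.
    by apply/measurable_EFinP/measurable_funM => //; exact: measurableT_comp.
  move: fin1; congr (_ < _)%E; under eq_integral.
    by move=> x _; rewrite /= normrM (ger0_norm (G10 _)); over.
  under [RHS]eq_integral.
    by move=> x _; rewrite /= normrM (ger0_norm (G20 _)); over.
  by rewrite /= (K (fun y => `|phi y|))//; exact: measurableT_comp.
have posE (T : Type) (X : T -> S) (G : T -> R) : (forall x, 0 <= G x) ->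
    ((fun x => (phi (X x) * G x)%:E)^\+)%E = (fun x => (phi^\+ (X x) * G x)%:E).
  move=> G0; apply/funext => x.
  by rewrite funeposE /funrpos maxr_pMl ?mul0r// EFin_max.
have negE (T : Type) (X : T -> S) (G : T -> R) : (forall x, 0 <= G x) ->
    ((fun x => (phi (X x) * G x)%:E)^\-)%E = (fun x => (phi^\- (X x) * G x)%:E).
  move=> G0; apply/funext => x.
  by rewrite funenegE /funrneg maxr_pMl ?mul0r ?mulNr// EFin_max.
rewrite integralE [RHS]integralE !posE// !negE//.
by rewrite K//; [rewrite K//; exact: measurable_funrneg|exact: measurable_funrpos].
Qed.

(** * Conditional expectations *)

Section condE0.
Context d dT (Omega : measurableType d) (T : measurableType dT) (R : realType).
Variable P : probability Omega R.
Implicit Types (X : Omega -> T) (U V : Omega -> R).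

(* E[U | X] = 0 *)
Definition condE0 X U := P.-integrable setT (EFin \o U) /\
  forall B, measurable B -> (\int[P]_(w in X @^-1` B) (U w)%:E = 0)%E.

Lemma integrable_measurable U : P.-integrable setT (EFin \o U) ->
  measurable_fun setT U.
Proof. by move=> /(measurable_int P)/measurable_EFinP. Qed.

Lemma integrable_ae_eq U V : P.-integrable setT (EFin \o U) ->
  measurable_fun setT V -> {ae P, forall w, U w = V w} ->
  P.-integrable setT (EFin \o V).
Proof.
move=> /integrableP[mU iU] mV UV; apply/integrableP; split.
  exact/measurable_EFinP.
move: iU; congr (_ < _)%E; apply: ae_eq_integral => //.
- exact: measurableT_comp.
- by apply: measurableT_comp => //; exact/measurable_EFinP.
- by apply: filterS UV => w /= ->.
Qed.

Lemma integrableDr U V : P.-integrable setT (EFin \o U) ->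
  P.-integrable setT (EFin \o V) ->
  P.-integrable setT (EFin \o (fun w => U w + V w)).
Proof. by move=> iU iV; have := integrableD measurableT iU iV. Qed.

Lemma integrableBr U V : P.-integrable setT (EFin \o U) ->
  P.-integrable setT (EFin \o V) ->
  P.-integrable setT (EFin \o (fun w => U w - V w)).
Proof. by move=> iU iV; have := integrableB measurableT iU iV. Qed.

Lemma integral_preimage X U (B : set T) :
  (\int[P]_(w in X @^-1` B) (U w)%:E = \int[P]_w (\1_B (X w) * U w)%:E)%E.
Proof.
rewrite integral_mkcond; apply: eq_integral => w _.
rewrite patchE indicE (_ : (w \in X @^-1` B) = (X w \in B)); last first.
  by apply/idP/idP; rewrite !inE.
by case: ifPn; rewrite ?mul1r ?mul0r.
Qed.

Lemma integrable_bounded U : measurable_fun setT U ->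
  (exists M : R, {ae P, forall w, `|U w| <= M}) ->
  P.-integrable setT (EFin \o U).
Proof.
move=> mU [M UM]; apply/integrableP; split; first exact/measurable_EFinP.
have M0 : (0 <= `|M|%:E)%E by rewrite lee_fin.
apply: (le_lt_trans (@integral_le_bound _ _ _ P setT (EFin \o U) `|M|%:E _ _ M0 _)) => //.
- exact/measurable_EFinP.
- by apply: filterS UM => w UM _; rewrite lee_fin (le_trans UM)// ler_norm.
- by rewrite [X in (_ * X)%E]probability_setT mule1 ltry.
Qed.

Lemma integrable_boundedM U V : P.-integrable setT (EFin \o U) ->
  measurable_fun setT V -> (exists M : R, {ae P, forall w, `|V w| <= M}) ->
  P.-integrable setT (EFin \o (fun w => V w * U w)).
Proof.
move=> iU mV [M VM]; have mU := integrable_measurable iU.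
apply/integrableP; split; first exact/measurable_EFinP/measurable_funM.
have /integrableP[mMU] := integrableZl measurableT `|M| iU.
apply: le_lt_trans; apply: ae_ge0_le_integral => //.
- by apply: measurableT_comp => //; exact/measurable_EFinP/measurable_funM.
- exact: measurableT_comp.
- apply: filterS VM => w VM _; rewrite /= lee_fin !normrM normr_id.
  by rewrite ler_wpM2r// (le_trans VM)// ler_norm.
Qed.

Lemma condE0D X U V : measurable_fun setT X -> condE0 X U -> condE0 X V ->
  condE0 X (fun w => U w + V w).
Proof.
move=> mX [iU U0] [iV V0]; split; first exact: integrableDr.
move=> B mB; have mXB := measurable_preimage mX mB.
have iXB W : P.-integrable setT W -> P.-integrable (X @^-1` B) W.
  exact: integrableS.
have := integralD_EFin mXB (iXB _ iU) (iXB _ iV).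
by rewrite U0// V0// adde0.
Qed.

Lemma condE0N X U : measurable_fun setT X -> condE0 X U ->
  condE0 X (fun w => - U w).
Proof.
move=> mX [iU U0]; split; first by have := integrableN iU.
move=> B mB; have mXB := measurable_preimage mX mB.
under eq_integral do rewrite EFinN.
rewrite integralN ?U0 ?oppe0//; apply: integrable_add_def => //.
exact: integrableS iU.
Qed.

Lemma condE0B X U V : measurable_fun setT X -> condE0 X U -> condE0 X V ->
  condE0 X (fun w => U w - V w).
Proof. by move=> mX XU XV; apply: condE0D => //; exact: condE0N. Qed.

Lemma condE0_ae X U V : measurable_fun setT X -> condE0 X U ->
  measurable_fun setT V -> {ae P, forall w, U w = V w} -> condE0 X V.
Proof.
move=> mX [iU U0] mV UV; split; first exact: integrable_ae_eq UV.
move=> B mB; rewrite -(U0 _ mB); apply: ae_eq_integral => //.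
- exact: measurable_preimage.
- exact/measurable_funTS/measurable_EFinP.
- exact/measurable_funTS/(measurable_int P).
- by apply: filterS UV => w /= ->.
Qed.

(** This puts a centred variable within reach of the transfer of integrals: its positive and
    negative parts are densities of two measures with the same image under [X]. *)
Lemma condE0_funrposneg X U : measurable_fun setT X -> condE0 X U ->
  forall B, measurable B ->
    (\int[P]_(w in X @^-1` B) (U^\+ w)%:E =
     \int[P]_(w in X @^-1` B) (U^\- w)%:E)%E.
Proof.
move=> mX [iU U0] B mB; have mXB := measurable_preimage mX mB.
have iUB : P.-integrable (X @^-1` B) (EFin \o U) by exact: integrableS iU.
have iUp := integrable_funrpos mXB iUB; have iUn := integrable_funrneg mXB iUB.
have fp := integrable_fin_num mXB iUp; have fn := integrable_fin_num mXB iUn.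
apply/eqP; rewrite -[X in _ == X]add0e -sube_eq ?fin_num_adde_defl//.
rewrite -integralB_EFin// -(U0 _ mB); apply/eqP/eq_integral => w _.
by rewrite -EFinB -[in RHS](funrposBneg U).
Qed.

(** The indicator of [B] is absorbed into the weight [psi]; the measures with densities [U^\+] and
    [U^\-] have the same image under [X], so they give [psi (X)] the same integral. *)
Lemma condE0M X U (phi : T -> R) : measurable_fun setT X ->
  measurable_fun setT phi -> condE0 X U ->
  P.-integrable setT (EFin \o (fun w => phi (X w) * U w)) ->
  condE0 X (fun w => phi (X w) * U w).
Proof.
move=> mX mphi cU iphiU; split=> // B mB.
have mU := integrable_measurable cU.1.
pose psi y := \1_B y * phi y.
have mpsi : measurable_fun setT psi.
  by apply: measurable_funM => //; exact: measurable_indic.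
rewrite integral_preimage.
have psiU V : measurable_fun setT V -> (forall w, `|V w| <= `|U w|) ->
    P.-integrable setT (EFin \o (fun w => psi (X w) * V w)).
  move=> mV VU; apply: le_integrable iphiU => //.
    by apply/measurable_EFinP/measurable_funM => //; exact: measurableT_comp.
  move=> w _; rewrite /= lee_fin /psi !normrM ler_pM// indicE. by case: (_ \in _); rewrite ?normr1 ?normr0 ?mul1r ?mul0r.
have ip : P.-integrable setT (EFin \o (fun w => psi (X w) * U^\+ w)).
  apply: psiU => [|w]; first exact: measurable_funrpos.
  by rewrite -[leRHS]/((Num.norm \o U) w) -funrposDneg ger0_norm// lerDl.
have im : P.-integrable setT (EFin \o (fun w => psi (X w) * U^\- w)).
  apply: psiU => [|w]; first exact: measurable_funrneg.
  by rewrite -[leRHS]/((Num.norm \o U) w) -funrposDneg ger0_norm// lerDr.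
have [_ pm] := integral_comp_eq mX mX (measurable_funrpos mU)
  (measurable_funrneg mU) (@funrpos_ge0 _ _ U) (@funrneg_ge0 _ _ U)
  (condE0_funrposneg mX cU) mpsi ip.
transitivity (\int[P]_w ((psi (X w) * U^\+ w)%:E - (psi (X w) * U^\- w)%:E))%E.
  apply: eq_integral => w _; rewrite -EFinB -mulrBr mulrA.
  by rewrite -[in LHS](funrposBneg U).
by rewrite integralB_EFin// pm subee// integrable_fin_num.
Qed.

(** Tested on the event where [g] is nonnegative, the hypothesis makes the integral of the absolute
    value of [g (X)] vanish there; the same argument applies to the opposite of [g]. *)
Lemma condE0_eq0 X (g : T -> R) : measurable_fun setT X ->
  measurable_fun setT g -> condE0 X (g \o X) -> {ae P, forall w, g (X w) = 0}.
Proof.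
move=> mX mg cg; have mgX : measurable_fun setT (g \o X) by exact: measurableT_comp.
have mnonneg (h : T -> R) : measurable_fun setT h ->
    measurable [set y | 0 <= h y].
  move=> mh; rewrite (_ : [set _ | _] = h @^-1` `[0, +oo[%classic).
    by apply: measurable_preimage.
  by apply/seteqP; split=> y /=; rewrite in_itv/= andbT.
have nonneg_eq0 (h : T -> R) : measurable_fun setT h -> condE0 X (h \o X) ->
    {ae P, forall w, 0 <= h (X w) -> h (X w) = 0}.
  move=> mh [_ ch]; have mB := measurable_preimage mX (mnonneg h mh).
  have : ae_eq P (X @^-1` [set y | 0 <= h y]) (EFin \o (h \o X)) (cst 0%E).
    apply/ae_eq_integral_abs => //.
      by apply/measurable_funTS/measurable_EFinP; exact: measurableT_comp.
    rewrite -[RHS](ch _ (mnonneg h mh)); apply: eq_integral => w.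
    by rewrite inE/= => h0; rewrite ger0_norm.
  by apply: filterS => w /= hw /hw [].
have Ng : {ae P, forall w, 0 <= - g (X w) -> - g (X w) = 0}.
  apply: (nonneg_eq0 (fun y => - g y)); first exact: measurableT_comp.
  exact: condE0N cg.
move: (nonneg_eq0 g mg cg) Ng; apply: filterS2 => w H1 H2.
have [/H1//|/ltW g0] := leP 0 (g (X w)).
by apply/eqP; rewrite -oppr_eq0; apply/eqP/H2; rewrite oppr_ge0.
Qed.
End condE0.

Lemma condE0_comp d dT dT' (Omega : measurableType d) (T : measurableType dT)
    (T' : measurableType dT') (R : realType) (P : probability Omega R)
    (X : Omega -> T) (p : T -> T') (U : Omega -> R) :
  measurable_fun setT p -> condE0 P X U -> condE0 P (p \o X) U.
Proof.
move=> mp [iU U0]; split=> // B mB; rewrite comp_preimage U0//.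
exact: measurable_preimage.
Qed.

Section is_condE.
Context d dT (Omega : measurableType d) (T : measurableType dT) (R : realType).
Variable P : probability Omega R.
Implicit Types (X : Omega -> T) (V : Omega -> R) (g h : T -> R).

(** With its converse below, this replaces regressions by centred residuals, which can be added,
    weighted and conditioned on coarser variables. *)
Lemma is_condE_condE0 X V g : measurable_fun setT X -> is_condE P X V g ->
  condE0 P X (fun w => V w - g (X w)).
Proof.
move=> mX [mg iV ig Vg]; split; first exact: integrableBr.
move=> B mB; have mXB := measurable_preimage mX mB.
have iS W : P.-integrable setT W -> P.-integrable (X @^-1` B) W.
  exact: integrableS.
have := integralB_EFin mXB (iS _ iV) (iS _ ig); rewrite Vg// => ->.
by rewrite subee// integrable_fin_num//; exact: iS.
Qed.

Lemma condE0_is_condE X V g : measurable_fun setT X -> measurable_fun setT g ->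
  P.-integrable setT (EFin \o (g \o X)) ->
  condE0 P X (fun w => V w - g (X w)) -> is_condE P X V g.
Proof.
move=> mX mg ig [iVg Vg].
have iV : P.-integrable setT (EFin \o V).
  have := integrableDr iVg ig; congr (integrable _ _ _).
  by apply/funext => w; rewrite /= subrK.
split=> // B mB; have mXB := measurable_preimage mX mB.
have iS W : P.-integrable setT W -> P.-integrable (X @^-1` B) W.
  exact: integrableS.
have := integralB_EFin mXB (iS _ iV) (iS _ ig); rewrite Vg// => /esym/eqP.
rewrite sube_eq ?add0e; first by move=> /eqP.
  by rewrite integrable_fin_num//; exact: iS.
by rewrite fin_num_adde_defr.
Qed.

Lemma is_condE_unique X V V' g g' : measurable_fun setT X ->
  is_condE P X V g -> is_condE P X V' g' -> {ae P, forall w, V w = V' w} ->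
  {ae P, forall w, g (X w) = g' (X w)}.
Proof.
move=> mX Vg Vg' VV'.
have mgg' : measurable_fun setT (fun y => g y - g' y).
  by apply: measurable_funB; [case: Vg|case: Vg'].
have : {ae P, forall w, g (X w) - g' (X w) = 0}.
  apply: (condE0_eq0 mX mgg').
  have := condE0B mX (is_condE_condE0 mX Vg') (is_condE_condE0 mX Vg).
  move=> /condE0_ae; apply=> //; first exact: measurableT_comp.
  by apply: filterS VV' => w -> /=; rewrite opprB addrC addrA subrK.
by apply: filterS => w /eqP; rewrite subr_eq0 => /eqP.
Qed.

Lemma is_condE_ae X V V' g : measurable_fun setT X -> is_condE P X V g ->
  measurable_fun setT V' -> {ae P, forall w, V w = V' w} -> is_condE P X V' g.
Proof.
move=> mX Vg mV' VV'; have [mg _ ig _] := Vg.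
apply: condE0_is_condE => //; apply: condE0_ae (is_condE_condE0 mX Vg) _ _ => //.
  by apply: measurable_funB => //; exact: measurableT_comp.
by apply: filterS VV' => w ->.
Qed.

(** On the event where [g (X)] is negative, the integral of its absolute value is minus that of [V],
    hence nonpositive, so the event is null. [V] is first replaced by [V^\+], which is nonnegative
    everywhere and not just almost surely. *)
Lemma is_condE_ge0 X V g : measurable_fun setT X -> is_condE P X V g ->
  {ae P, forall w, 0 <= V w} -> {ae P, forall w, 0 <= g (X w)}.
Proof.
move=> mX Vg0 V0; have [mg iV _ _] := Vg0.
have [_ _ ig VgE] : is_condE P X V^\+ g.
  apply: is_condE_ae Vg0 _ _ => //.
    by apply: measurable_funrpos; exact: integrable_measurable iV.
  by apply: filterS V0 => w V0; rewrite /funrpos max_l.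
pose B := [set y | g y < 0].
have mB : measurable B.
  rewrite (_ : B = g @^-1` `]-oo, 0[%classic); first exact: measurable_preimage.
  by apply/seteqP; split=> y /=; rewrite in_itv.
have mXB := measurable_preimage mX mB.
have : ae_eq P (X @^-1` B) (EFin \o (g \o X)) (cst 0%E).
  apply/ae_eq_integral_abs => //.
    by apply/measurable_funTS/measurable_EFinP; exact: measurableT_comp.
  apply/eqP; rewrite eq_le; apply/andP; split; last exact: integral_ge0.
  have -> : (\int[P]_(w in X @^-1` B) `|(EFin \o (g \o X)) w| =
             \int[P]_(w in X @^-1` B) - (g (X w))%:E)%E.
    by apply: eq_integral => w; rewrite inE/= => gw; rewrite ltr0_norm.
  rewrite integralN; last by apply: integrable_add_def => //; exact: integrableS ig.
  by rewrite -VgE// oppe_le0; apply: integral_ge0 => w _; rewrite lee_fin.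
apply: filterS => w /= gXw; rewrite leNgt; apply/negP => gw.
by have [gw0] := gXw gw; rewrite gw0 ltxx in gw.
Qed.

(** Only [h (X) * V] is assumed integrable; the integrability of [h (X) * g (X)] is derived. Once it
    is known, the identity is [condE0M] applied to the residual. *)
Lemma is_condE_pullout X V g h : measurable_fun setT X -> is_condE P X V g ->
  measurable_fun setT h ->
  P.-integrable setT (EFin \o (fun w => h (X w) * V w)) ->
  is_condE P X (fun w => h (X w) * V w) (fun y => h y * g y).
Proof.
move=> mX Vg mh ihV; have [mg iV ig _] := Vg.
have mV := integrable_measurable iV.
have mhX : measurable_fun setT (h \o X) by exact: measurableT_comp.
have mgX : measurable_fun setT (g \o X) by exact: measurableT_comp.
have cW := is_condE_condE0 mX Vg; set W := (X in condE0 _ _ X) in cW.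
have mW := integrable_measurable cW.1.
have mWp := measurable_funrpos mW; have mWn := measurable_funrneg mW.
pose B := [set y | 0 <= g y].
have mB : measurable B.
  rewrite (_ : B = g @^-1` `[0, +oo[%classic); first exact: measurable_preimage.
  by apply/seteqP; split=> y /=; rewrite in_itv/= andbT.
have mhB C : measurable C -> measurable_fun setT (fun y => \1_C y * h y).
  by move=> mC; apply: measurable_funM => //; exact: measurable_indic.
have dom C (F : Omega -> R) : measurable C -> measurable_fun setT F ->
    (forall w, C (X w) -> `|F w| <= `|V w|) ->
    P.-integrable setT (EFin \o (fun w => \1_C (X w) * h (X w) * F w)).
  move=> mC mF FV; apply: le_integrable ihV => //.
    apply/measurable_EFinP/measurable_funM => //.
    exact: (measurableT_comp (mhB _ mC)).
  move=> w _; rewrite /= lee_fin indicE; have [|_] := boolP (X w \in C).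
    by rewrite inE => /FV ?; rewrite mul1r !normrM ler_wpM2l.
  by rewrite !mul0r normr0.
(* Where g(X) >= 0 the positive part of W = V - g(X) is dominated by |V|, and
   the integrability passes to the negative part since both have the same
   integrals on X-measurable sets; symmetrically where g(X) < 0. *)
have i1 : P.-integrable setT (EFin \o (fun w => \1_B (X w) * h (X w) * W^\+ w)).
  apply: dom => // w /= gw; rewrite ger0_norm// /funrpos ge_max normr_ge0 andbT.
  by rewrite /W (le_trans _ (ler_norm _))// gerBl.
have [i2 _] := integral_comp_eq mX mX mWp mWn (@funrpos_ge0 _ _ W)
  (@funrneg_ge0 _ _ W) (condE0_funrposneg mX cW) (mhB _ mB) i1.
have i3 : P.-integrable setT
    (EFin \o (fun w => \1_(~` B) (X w) * h (X w) * W^\- w)).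
  apply: dom => //; first exact: measurableC.
  move=> w /= /negP; rewrite -ltNge => gw.
  rewrite ger0_norm// /funrneg ge_max normr_ge0 andbT /W opprB.
  by rewrite -normrN (le_trans _ (ler_norm _))// gerDr ltW.
have [i4 _] := integral_comp_eq mX mX mWn mWp (@funrneg_ge0 _ _ W)
  (@funrpos_ge0 _ _ W) (fun C mC => esym (condE0_funrposneg mX cW mC))
  (mhB _ (measurableC mB)) i3.
have ihW : P.-integrable setT (EFin \o (fun w => h (X w) * W w)).
  have := integrableDr (integrableBr i1 i2) (integrableBr i4 i3).
  congr (integrable _ _ _); apply/funext => w /=; congr EFin.
  rewrite -!mulrBr -[W^\+ w - _]/((W^\+ - W^\-) w) funrposBneg -mulrDl -mulrDl.
  by rewrite !indicE in_setC; case: (_ \in _); rewrite ?addr0 ?add0r mul1r.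
apply: condE0_is_condE => //.
- exact: measurable_funM.
- have := integrableBr ihV ihW; congr (integrable _ _ _).
  by apply/funext => w /=; rewrite -mulrBr /W opprB addrC subrK.
- have := condE0M mX mh cW ihW; congr (condE0 _ _ _).
  by apply/funext => w; rewrite /W mulrBr.
Qed.
End is_condE.

(** * Existence of conditional expectations *)

Section is_condE_exists.
Context d dT (Omega : measurableType d) (T : measurableType dT) (R : realType).
Variables (P : probability Omega R) (X : Omega -> T).
Hypothesis mX : measurable_fun setT X.
Let mfX : {mfun Omega >-> T} := HB.pack X (isMeasurableFun.Build _ _ _ _ _ mX).

(** The regression is the Radon-Nikodym derivative, with respect to the law of [X], of the image
    under [X] of the signed measure with density [V]. The derivative is finite everywhere, so [fine]
    loses nothing. *)
Lemma is_condE_exists (V : Omega -> R) : P.-integrable setT (EFin \o V) ->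
  exists g, is_condE P X V g.
Proof.
move=> iV.
pose nu0 : {charge set Omega -> \bar R} := induced_charge iV.
pose nu : {charge set T -> \bar R} :=
  measure_function_pushforward__canonical__charge_Charge nu0 mX.
pose PX : probability T R := distribution P mfX.
have nuPX : nu `<< PX.
  apply/null_content_dominatesP => B mB PB; apply: null_set_integral => //.
  - exact: measurable_preimage.
  - exact/measurable_funTS/(measurable_int P).
pose f := Radon_Nikodym nu PX; have fE x : f x = (fine (f x))%:E.
  by rewrite fineK// Radon_Nikodym_fin_num.
have if_ : PX.-integrable setT f by exact: Radon_Nikodym_integrable.
have mf : measurable_fun setT f := measurable_int _ if_.
have mfine : measurable_fun setT (fine \o f) by exact: measurableT_comp.
have ifX : P.-integrable setT (EFin \o ((fine \o f) \o X)).
  have -> : EFin \o ((fine \o f) \o X) = f \o X.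
    by apply/funext => w /=; rewrite -fE.
  have /integrableP[_ foo] := if_; apply/integrableP; split.
    exact: measurableT_comp.
  rewrite -(@ge0_integral_distribution _ _ _ _ _ P mfX (abse \o f))//.
    exact: measurableT_comp.
  by move=> y; exact: abse_ge0.
exists (fun x => fine (f x)); split=> // B mB.
transitivity (nu B) => //.
rewrite (Radon_Nikodym_integral nuPX mB) integral_pushforward//.
  by apply: eq_integral => w _ /=; rewrite -fE.
apply: (integrableS measurableT) => //; first exact: measurable_preimage.
by move: ifX; congr (integrable _ _ _); apply/funext => w /=; rewrite -fE.
Qed.

End is_condE_exists.

(** * Centring checked on a generating class *)

(** Dynkin's argument: the sets over which [U] integrates to zero form a lambda-system. The total
    integral is a separate hypothesis because [G] need not contain the whole space, while
    complements require it. *)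
Lemma condE0_generated d dT (Omega : measurableType d) (T : measurableType dT)
    (R : realType) (P : probability Omega R) (X : Omega -> T) (U : Omega -> R)
    (G : set (set T)) :
  measurable_fun setT X -> @measurable _ T = <<s G >> -> setI_closed G ->
  P.-integrable setT (EFin \o U) -> (\int[P]_w (U w)%:E = 0)%E ->
  (forall B, G B -> (\int[P]_(w in X @^-1` B) (U w)%:E = 0)%E) ->
  condE0 P X U.
Proof.
move=> mX GE GI iU UT U0; split=> // B mB.
pose Q := [set B : set T | (\int[P]_(w in X @^-1` B) (U w)%:E = 0)%E].
have iS C : measurable C -> P.-integrable (X @^-1` C) (EFin \o U).
  by move=> mC; apply: integrableS iU => //; exact: measurable_preimage.
have QT : Q setT by rewrite /Q/= preimage_setT.
apply: (dynkin_induction (G := G) (P := Q)) => //.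
- move=> S mS QS; rewrite /Q/=.
  have := @integral_setU _ _ _ P (X @^-1` S) (X @^-1` (~` S)) (EFin \o U).
  rewrite -preimage_setU setUv preimage_setT.
  rewrite (_ : integral P setT _ = 0%E); last by rewrite -QT preimage_setT.
  rewrite (_ : integral P (X @^-1` S) _ = 0%E)// add0e => ->//.
  + exact: measurable_preimage.
  + by apply: measurable_preimage => //; exact: measurableC.
  + exact: (measurable_int P).
  + by rewrite disj_set2E -preimage_setI setICr preimage_set0.
- move=> F mF tF QF; rewrite /Q/= preimage_bigcup integral_bigcup//.
  + by apply: eseries0 => n _ _; exact: QF.
  + apply/trivIsetP => i j _ _ ij; rewrite -preimage_setI.
    by move/trivIsetP : tF => /(_ _ _ I I ij) ->; rewrite preimage_set0.
  + by move=> n; exact: measurable_preimage.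
  + by rewrite -preimage_bigcup; apply: iS; exact: bigcup_measurable.
- by rewrite -GE.
Qed.

Lemma condE0_rect d d1 d2 (Omega : measurableType d) (T1 : measurableType d1)
    (T2 : measurableType d2) (R : realType) (P : probability Omega R)
    (X1 : Omega -> T1) (X2 : Omega -> T2) (U : Omega -> R) :
  measurable_fun setT X1 -> measurable_fun setT X2 ->
  P.-integrable setT (EFin \o U) ->
  (forall B1 B2, measurable B1 -> measurable B2 ->
    (\int[P]_(w in X1 @^-1` B1 `&` X2 @^-1` B2) (U w)%:E = 0)%E) ->
  condE0 P (fun w => (X1 w, X2 w)) U.
Proof.
move=> mX1 mX2 iU U0.
apply: (condE0_generated
  (G := [set A `*` B | A in @measurable _ T1 & B in @measurable _ T2])) => //.
- exact: measurable_fun_pair.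
- exact: measurable_prod_measurableType.
- move=> _ _ [A1 mA1 [A2 mA2 <-]] [B1 mB1 [B2 mB2 <-]].
  exists (A1 `&` B1); first exact: measurableI.
  by exists (A2 `&` B2); [exact: measurableI|rewrite setXI].
- by rewrite -[RHS](U0 setT setT)// !preimage_setT setTI.
- by move=> _ [A1 mA1 [A2 mA2 <-]]; rewrite -[RHS](U0 A1 A2).
Qed.

(** * Conditional independence *)

Section cond_indep.
Context d dT (Omega : measurableType d) (T : measurableType dT) (R : realType).
Variables (P : probability Omega R) (X : Omega -> T).
Hypothesis mX : measurable_fun setT X.

Lemma is_condE_itv01 (V : Omega -> R) g : is_condE P X V g ->
  (forall w, 0 <= V w <= 1) -> {ae P, forall w, 0 <= g (X w) <= 1}.
Proof.
move=> Vg V01; have [mg iV ig _] := Vg.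
have i1 : P.-integrable setT (EFin \o cst (1 : R)).
  exact: finite_measure_integrable_cst.
have Vg1 : is_condE P X (fun w => 1 - V w) (fun y => 1 - g y).
  apply: condE0_is_condE => //.
  - exact: measurable_funB.
  - exact: (integrableBr i1 ig).
  - have := condE0N mX (is_condE_condE0 mX Vg); congr (condE0 _ _ _).
    by apply/funext => w; ring.
have g0 : {ae P, forall w, 0 <= g (X w)}.
  by apply: (is_condE_ge0 mX Vg); apply: nearW => w; case/andP: (V01 w).
have g1 : {ae P, forall w, 0 <= 1 - g (X w)}.
  apply: (is_condE_ge0 mX Vg1); apply: nearW => w.
  by rewrite subr_ge0; case/andP: (V01 w).
by move: g0 g1; apply: filterS2 => w -> ; rewrite subr_ge0.
Qed.

Lemma is_condE_tower d' (T' : measurableType d') (p : T -> T') (V : Omega -> R)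
    g g' : measurable_fun setT p -> is_condE P X V g ->
  is_condE P (p \o X) V g' -> is_condE P (p \o X) (g \o X) g'.
Proof.
move=> mp Vg Vg'; have [_ _ ig _] := Vg; have [mg' _ ig' _] := Vg'.
have mpX : measurable_fun setT (p \o X) by exact: measurableT_comp.
apply: condE0_is_condE => //.
have := condE0B mpX (is_condE_condE0 mpX Vg')
  (condE0_comp mp (is_condE_condE0 mX Vg)).
congr (condE0 _ _ _); apply/funext => w /=.
by rewrite opprB addrC addrA subrK.
Qed.

Lemma indic_preimage (S : Type) (W : Omega -> S) (C : set S) w :
  \1_(W @^-1` C) w = \1_C (W w) :> R.
Proof.
by rewrite !indicE.
Qed.

Lemma measurable_indic_comp d' (S : measurableType d') (W : Omega -> S) C :
  measurable_fun setT W -> measurable C ->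
  measurable_fun setT (fun w => \1_C (W w) : R).
Proof.
move=> mW mC; have mI : measurable_fun setT (\1_C : S -> R).
  exact: measurable_indic.
exact: measurableT_comp mI mW.
Qed.

Lemma indic_bounded (S : Type) (C : set S) x : `|\1_C x : R| <= 1.
Proof. by rewrite indicE; case: (_ \in _); rewrite ?normr1 ?normr0. Qed.

Lemma condE0_pair d' (S : measurableType d') (W : Omega -> S) (U : Omega -> R) :
  measurable_fun setT W -> P.-integrable setT (EFin \o U) ->
  (forall C, measurable C -> condE0 P X (fun w => \1_C (W w) * U w)) ->
  condE0 P (fun w => (W w, X w)) U.
Proof.
move=> mW iU UC; apply: condE0_rect => // C D mC mD.
have [_ /(_ D mD) <-] := UC C mC.
rewrite setIC integral_mkcondr; apply: eq_integral => w _.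
rewrite patchE -indic_preimage indicE.
by case: ifPn; rewrite ?mul1r ?mul0r.
Qed.

Section two_variables.
Context d1 d2 (T1 : measurableType d1) (T2 : measurableType d2).
Variables (V : Omega -> T1) (W : Omega -> T2).
Hypotheses (mV : measurable_fun setT V) (mW : measurable_fun setT W).

Lemma cond_indep_sym : cond_indep P V W X -> cond_indep P W V X.
Proof.
move=> VW B C mB mC; have [pC [pB [hC hB hBC]]] := VW C B mC mB.
exists pB, pC; split=> //; rewrite setIC; move: hBC; congr (is_condE _ _ _ _).
by apply/funext => y /=; rewrite mulrC.
Qed.

(** Multiplied by the indicator of [W] in [C], both terms have the regression [pB * pC] on [X]: the
    first by conditional independence, the second by pulling [pB (X)] out. The given version [p]
    agrees with [pB] almost surely. *)
Lemma cond_indep_indic B p : cond_indep P V W X -> measurable B ->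
  is_condE P X (\1_(V @^-1` B)) p ->
  condE0 P (fun w => (W w, X w)) (fun w => \1_B (V w) - p (X w)).
Proof.
move=> VW mB hp; have [mp i1 ip _] := hp.
have mBV : measurable_fun setT (fun w => \1_B (V w) : R).
  exact: measurable_indic_comp.
have iB : P.-integrable setT (EFin \o (fun w => \1_B (V w))).
  by apply: integrable_bounded => //; exists 1; apply: nearW => w; exact: indic_bounded.
apply: condE0_pair => //; first exact: (integrableBr iB ip).
move=> C mC; have [pB [pC [hB hC hBC]]] := VW B C mB mC.
have [mpB _ ipB _] := hB; have [mpC _ _ _] := hC.
have mCW : measurable_fun setT (fun w => \1_C (W w) : R).
  exact: measurable_indic_comp.
have bC : exists M : R, {ae P, forall w, `|\1_C (W w)| <= M}.
  by exists 1; apply: nearW => w; exact: indic_bounded.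
have iBC : P.-integrable setT (EFin \o (fun w => pB (X w) * \1_(W @^-1` C) w)).
  have := integrable_boundedM ipB mCW bC; congr (integrable _ _ _).
  by apply/funext => w /=; rewrite indic_preimage mulrC.
have := condE0B mX (is_condE_condE0 mX hBC)
  (is_condE_condE0 mX (is_condE_pullout mX hC mpB iBC)).
move=> /condE0_ae; apply=> //.
  apply: measurable_funM => //; apply: measurable_funB => //.
  exact: measurableT_comp.
apply: filterS (is_condE_unique mX hp hB (nearW _ (fun=> erefl))) => w ->.
by rewrite indicI /= !indic_preimage; ring.
Qed.

End two_variables.

(** Writing 1 for the indicator of [W] in [C] and p for its regression on [X], one has 1 (F - h) = F
    (1 - p) + p (F - h) - h (1 - p). The first term is centred given [(V, X)] by the previous lemma
    with the roles of [V] and [W] exchanged, the other two given [X]. As 1 and p are bounded, [F]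
    needs no truncation. *)
Lemma cond_indep_condE d1 d2 (T1 : measurableType d1) (T2 : measurableType d2)
    (V : Omega -> T1) (W : Omega -> T2) (F : T1 * T -> R) h :
  measurable_fun setT V -> measurable_fun setT W -> cond_indep P V W X ->
  measurable_fun setT F -> is_condE P X (fun w => F (V w, X w)) h ->
  condE0 P (fun w => (W w, X w)) (fun w => F (V w, X w) - h (X w)).
Proof.
move=> mV mW VW mF hF; have [mh iF ih _] := hF.
apply: condE0_pair => //; first exact: (integrableBr iF ih).
move=> C mC; have [_ [pC [_ hC _]]] := VW setT C measurableT mC.
have [mpC _ _ _] := hC.
have mpCX : measurable_fun setT (fun w => pC (X w)) by exact: measurableT_comp.
have mCW : measurable_fun setT (fun w => \1_C (W w) : R).
  exact: measurable_indic_comp.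
have bC : exists M : R, {ae P, forall w, `|\1_C (W w)| <= M}.
  by exists 1; apply: nearW => w; exact: indic_bounded.
have bpC : exists M : R, {ae P, forall w, `|pC (X w)| <= M}.
  exists 1; apply: filterS (is_condE_itv01 hC _) => w.
    by move=> /andP[p0 p1]; rewrite ger0_norm.
  by rewrite indicE; case: (_ \in _); rewrite lexx ler01.
pose VX w := (V w, X w); have mVX : measurable_fun setT VX by exact: measurable_fun_pair.
have iCF : P.-integrable setT (EFin \o (fun w => \1_C (W w) * F (VX w))).
  exact: integrable_boundedM.
have ipF : P.-integrable setT (EFin \o (fun w => pC (X w) * F (VX w))).
  exact: integrable_boundedM.
have c1 : condE0 P X (fun w => F (VX w) * (\1_C (W w) - pC (X w))).
  apply: (condE0_comp (X := VX) (p := snd)) => //.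
  apply: condE0M => //.
  - exact: (cond_indep_indic mW mV (cond_indep_sym VW) mC hC).
  - have := integrableBr iCF ipF; congr (integrable _ _ _).
    by apply/funext => w /=; congr EFin; ring.
have c2 : condE0 P X (fun w => pC (X w) * (F (VX w) - h (X w))).
  apply: (condE0M mX mpC (is_condE_condE0 mX hF)).
  exact: integrable_boundedM (integrableBr iF ih) _ _.
have c3 : condE0 P X (fun w => h (X w) * (\1_C (W w) - pC (X w))).
  apply: (condE0M mX mh).
    exact: is_condE_condE0 mX hC.
  have := integrableBr (integrable_boundedM ih mCW bC)
    (integrable_boundedM ih mpCX bpC); congr (integrable _ _ _).
  by apply/funext => w /=; congr EFin; ring.
have := condE0B mX (condE0D mX c1 c2) c3.
by congr (condE0 _ _ _); apply/funext => w; rewrite /VX; ring.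
Qed.

End cond_indep.

(** * Conditional densities *)

Lemma ge0_integral_preimageC d d' (T : measurableType d) (S : measurableType d')
    (R : realType) (mu : {measure set T -> \bar R}) (X : T -> S) (G : T -> R) B :
  measurable_fun setT X -> measurable_fun setT G -> (forall x, 0 <= G x) ->
  measurable B -> (\int[mu]_(x in X @^-1` B) (G x)%:E)%E \is a fin_num ->
  (\int[mu]_(x in X @^-1` (~` B)) (G x)%:E =
   \int[mu]_x (G x)%:E - \int[mu]_(x in X @^-1` B) (G x)%:E)%E.
Proof.
move=> mX mG G0 mB finB; rewrite -[LHS](addeK _ finB); congr (_ - _)%E.
rewrite addeC -ge0_integral_setU -?preimage_setU ?setUv//.
- exact: measurable_preimage.
- by apply: measurable_preimage => //; exact: measurableC.
- by apply/measurable_funTS/measurable_EFinP.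
- by move=> x _; rewrite lee_fin.
- by rewrite disj_set2E -preimage_setI setICr preimage_set0.
Qed.

Section ge0_integral_rect.
Local Open Scope ereal_scope.
Context d1 d2 d3 d4 (T1 : measurableType d1) (T2 : measurableType d2)
  (S1 : measurableType d3) (S2 : measurableType d4) (R : realType).
Variables (mu1 : {measure set T1 -> \bar R}) (mu2 : {measure set T2 -> \bar R}).
Variables (X1 : T1 -> S1 * S2) (X2 : T2 -> S1 * S2) (G1 : T1 -> R) (G2 : T2 -> R).

(** Dynkin's argument on the rectangles. Complements are obtained by subtraction, which the
    finiteness of the first integral permits; [mu2] itself may be infinite, as it is allowed to be
    for the product of [nu] and [P]. *)
Lemma ge0_integral_rect :
  measurable_fun setT X1 -> measurable_fun setT X2 ->
  measurable_fun setT G1 -> measurable_fun setT G2 ->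
  (forall x, (0 <= G1 x)%R) -> (forall x, (0 <= G2 x)%R) ->
  \int[mu1]_x (G1 x)%:E < +oo ->
  (forall B1 B2, measurable B1 -> measurable B2 ->
    \int[mu1]_(x in X1 @^-1` (B1 `*` B2)) (G1 x)%:E =
    \int[mu2]_(x in X2 @^-1` (B1 `*` B2)) (G2 x)%:E) ->
  forall B, measurable B -> \int[mu1]_(x in X1 @^-1` B) (G1 x)%:E =
                            \int[mu2]_(x in X2 @^-1` B) (G2 x)%:E.
Proof.
move=> mX1 mX2 mG1 mG2 G10 G20 fin1 G12.
pose G := [set A `*` B | A in @measurable _ S1 & B in @measurable _ S2].
pose I1 B := \int[mu1]_(x in X1 @^-1` B) (G1 x)%:E.
pose I2 B := \int[mu2]_(x in X2 @^-1` B) (G2 x)%:E.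
have GE : @measurable _ (S1 * S2)%type = <<s G >>.
  exact: measurable_prod_measurableType.
have I12T : I1 setT = I2 setT by rewrite -setXTT /I1 G12.
have I1fin B : measurable B -> I1 B \is a fin_num.
  move=> mB; rewrite ge0_fin_numE; last by apply: integral_ge0 => x _; rewrite lee_fin.
  apply: le_lt_trans fin1; apply: ge0_subset_integral => //.
  - exact: measurable_preimage.
  - exact/measurable_EFinP.
  - by move=> x _; rewrite lee_fin.
move=> B; rewrite GE; move: B.
apply: (dynkin_induction (P := [set B | I1 B = I2 B])) => //.
- move=> _ _ [A1 mA1 [A2 mA2 <-]] [B1 mB1 [B2 mB2 <-]].
  exists (A1 `&` B1); first exact: measurableI.
  by exists (A2 `&` B2); [exact: measurableI|rewrite setXI].
- by move=> _ [A1 mA1 [A2 mA2 <-]]; exact: G12.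
- move=> S mS /= IS; have finS := I1fin _ mS; rewrite /I1 /I2.
  rewrite !ge0_integral_preimageC//; last by rewrite -/(I2 S) -IS.
  by rewrite -/(I2 S) -/(I1 S) IS; move: I12T; rewrite /I1 /I2 !preimage_setT => ->.
- move=> F mF tF IF; rewrite /= /I1 /I2 !preimage_bigcup.
  rewrite !ge0_integral_bigcup//.
  + by apply: eq_eseriesr => n _; exact: IF.
  + by move=> n; exact: measurable_preimage.
  + by apply/measurable_funTS/measurable_EFinP.
  + by move=> x _; rewrite lee_fin.
  + apply/trivIsetP => i j _ _ ij; rewrite -preimage_setI.
    by move/trivIsetP : tF => /(_ _ _ I I ij) ->; rewrite preimage_set0.
  + by move=> n; exact: measurable_preimage.
  + by apply/measurable_funTS/measurable_EFinP.
  + by move=> x _; rewrite lee_fin.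
  + apply/trivIsetP => i j _ _ ij; rewrite -preimage_setI.
    by move/trivIsetP : tF => /(_ _ _ I I ij) ->; rewrite preimage_set0.
Qed.

End ge0_integral_rect.

(** The defining identity of the kernel, given on rectangles, extends by Dynkin's argument to every
    measurable set of the product. It is needed for null sets whose section varies with the value of
    [X]. *)
Lemma cond_law_xsection d d1 dT (Omega : measurableType d)
    (T1 : measurableType d1) (T : measurableType dT) (R : realType)
    (P : probability Omega R) (X : Omega -> T) (V : Omega -> T1)
    (k : R.-pker T ~> T1) (N : set (T * T1)) :
  measurable_fun setT X -> measurable_fun setT V -> is_cond_law P X V k ->
  measurable N ->
  P ((fun w => (X w, V w)) @^-1` N) = (\int[P]_w k (X w) (xsection N (X w)))%E.
Proof.
move=> mX mV kXV.
pose XV w := (X w, V w); have mXV : measurable_fun setT XV by exact: measurable_fun_pair.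
pose G := [set A `*` B | A in @measurable _ T & B in @measurable _ T1].
have GE : @measurable _ (T * T1)%type = <<s G >>.
  exact: measurable_prod_measurableType.
have mk S : measurable S -> measurable_fun setT (fun w => k (X w) (xsection S (X w))).
  move=> mS; apply: (measurableT_comp (f := fun x => k x (xsection S x))) => //.
  by apply: measurable_fun_xsection_finite_kernel; rewrite inE.
have k1 x S : measurable S -> (k x S <= 1)%E.
  move=> mS; rewrite -(prob_kernel (s := k) x); apply: le_measure => //; rewrite inE//.
move: N; rewrite GE.
apply: (dynkin_induction (P := [set S | P (XV @^-1` S) =
    (\int[P]_w k (X w) (xsection S (X w)))%E])) => //.
- move=> _ _ [A1 mA1 [A2 mA2 <-]] [B1 mB1 [B2 mB2 <-]].
  exists (A1 `&` B1); first exact: measurableI.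
  by exists (A2 `&` B2); [exact: measurableI|rewrite setXI].
- rewrite /= preimage_setT; transitivity (1%E : \bar R).
    exact: probability_setT.
  transitivity (\int[P]_w cst 1%E w)%E.
    by rewrite integral_cst// [X in (_ * X)%E]probability_setT mule1.
  by apply: eq_integral => w _; rewrite xsectionE preimage_setT prob_kernel.
- move=> _ [A mA [B mB <-]] /=.
  rewrite [LHS](kXV A B mA mB) integral_mkcond; apply: eq_integral => w _.
  rewrite patchE (_ : (w \in X @^-1` A) = (X w \in A)); last first.
    by apply/idP/idP; rewrite !inE.
  by case: ifPn => XA; [rewrite in_xsectionX|rewrite notin_xsectionX// measure0].
- move=> S mS /= IS; rewrite preimage_setC probability_setC; last exact: measurable_preimage.
  rewrite IS.
  have fS : P.-integrable setT (fun w => k (X w) (xsection S (X w))).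
    apply/integrableP; split; first exact: mk.
    apply: (@le_lt_trans _ _ (\int[P]_w cst 1%E w)%E).
      apply: ge0_le_integral => //; first by apply: measurableT_comp => //; exact: mk.
      by move=> w _; rewrite gee0_abs//= k1//; exact: measurable_xsection.
    by rewrite integral_cst// [X in (_ * X)%E]probability_setT mule1 ltry.
  have := @integralB _ _ _ P setT measurableT (cst 1%E) _ _ fS.
  rewrite integral_cst// [X in (_ * X)%E]probability_setT mule1 => <-; last first.
    exact: (finite_measure_integrable_cst P 1).
  apply: eq_integral => w _ /=.
  rewrite (_ : xsection (~` S) (X w) = ~` xsection S (X w)); last first.
    by rewrite !xsectionE preimage_setC.
  rewrite -setTD measureD//; last 2 first.
  + exact: measurable_xsection.
  + by rewrite (le_lt_trans (k1 _ _ measurableT))// ltry.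
  by congr (_ - _)%E; [exact/esym/prob_kernel|rewrite setTI].
- move=> F mF tF IF; rewrite /= preimage_bigcup measure_bigcup//.
  + transitivity (\int[P]_w \sum_(n <oo) k (X w) (xsection (F n) (X w)))%E.
      rewrite integral_nneseries//; last by move=> n; exact: mk.
      rewrite (@eq_eseriesl _ _ xpredT) => [|n]; last by rewrite in_setT.
      by apply: eq_eseriesr => n _; exact: IF.
    apply: eq_integral => w _; rewrite xsection_bigcup measure_bigcup//.
    * by apply/esym/eq_eseriesl => n; rewrite in_setT.
    * by move=> n _; exact: measurable_xsection.
    * exact: trivIset_xsection.
  + by move=> n _; exact: measurable_preimage.
  + apply/trivIsetP => i j _ _ ij; rewrite -preimage_setI.
    by move/trivIsetP : tF => /(_ _ _ I I ij) ->; rewrite preimage_set0.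
Qed.

Lemma product_probability_sigma_finite d1 d2 (T1 : measurableType d1)
    (T2 : measurableType d2) (R : realType)
    (m1 : {sigma_finite_measure set T1 -> \bar R}) (m2 : probability T2 R) :
  sigma_finite setT (m1 \x m2)%E.
Proof.
have [F FT Ffin] := sigma_finiteT m1.
exists (fun n => F n `*` setT).
  rewrite -setXTT FT; apply/seteqP; split=> [[x y] [[n _ Fnx] _]|[x y] [n _ [Fnx _]]].
    by exists n.
  by split=> //; exists n.
move=> n; have [mF Foo] := Ffin n; split; first exact: measurableX.
by rewrite [X in (X < _)%E]product_measure1E// [X in (_ * X)%E]probability_setT mule1.
Qed.

Section density.
Context d dT dS (Omega : measurableType d) (TZ : measurableType dT)
  (TL : measurableType dS) (R : realType) (P : probability Omega R).
Variables (Z : Omega -> TZ) (L : Omega -> TL).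
Hypotheses (mZ : measurable_fun setT Z) (mL : measurable_fun setT L).
Variable nu : {sigma_finite_measure set TZ -> \bar R}.
Let mfL : {mfun Omega >-> TL} := HB.pack L (isMeasurableFun.Build _ _ _ _ _ mL).
Let PL : probability TL R := distribution P mfL.
Let ZL w := (Z w, L w).
Let mZL : measurable_fun setT ZL. Proof. exact: measurable_fun_pair. Qed.
Let mfZL : {mfun Omega >-> (TZ * TL)%type} :=
  HB.pack ZL (isMeasurableFun.Build _ _ _ _ _ mZL).
Let PZL : probability (TZ * TL)%type R := distribution P mfZL.

(** If [N] is null for the product of [nu] and the law of [L], almost every section of [N] is
    [nu]-null, hence null for [k], and the disintegration makes [N] null for the law of (Z, L);
    Radon-Nikodym gives the density. The integral is written over [TZ] times [Omega], so that [U]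
    can be brought in later. *)
Lemma cond_dominated_density dA (TA : measurableType dA) (A : Omega -> TA)
    (k : R.-pker TL ~> (TZ * TA)%type) :
  measurable_fun setT A -> is_cond_law P L (fun w => (Z w, A w)) k ->
  (forall w B, measurable B -> nu B = 0%E -> k (L w) (B `*` setT) = 0%E) ->
  exists rho : TZ * TL -> R,
    [/\ measurable_fun setT rho, forall x, 0 <= rho x &
        forall B, measurable B -> P (ZL @^-1` B) =
          (\int[(nu \x P)%E]_(x in (fun x => (x.1, L x.2)) @^-1` B)
            (rho (x.1, L x.2))%:E)%E].
Proof.
move=> mA kP knu.
have mZA : measurable_fun setT (fun w => (Z w, A w)) by exact: measurable_fun_pair.
pose nuPL : {sigma_finite_measure set (TZ * TL)%type -> \bar R} :=
  HB.pack_for {sigma_finite_measure set (TZ * TL)%type -> \bar R}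
    (Measure.sort (nu \x PL)%E) (Measure_isSigmaFinite.Build _ _ _ (nu \x PL)%E
    (product_probability_sigma_finite nu PL)).
have dom : PZL `<< (nu \x PL)%E.
  apply/null_content_dominatesP => N mN N0.
  have mNy : measurable_fun setT (fun l => nu (ysection N l)).
    exact: measurable_fun_ysection.
  have aeN : {ae P, forall w, nu (ysection N (L w)) = 0%E}.
    have : (\int[P]_w `|nu (ysection N (L w))| = 0)%E.
      under eq_integral do rewrite gee0_abs//.
      rewrite -(@ge0_integral_distribution _ _ _ _ _ P mfL (fun l => nu (ysection N l)))//.
      rewrite -N0 [RHS](@product_measure_unique _ _ _ _ _ nu PL (nu \x^ PL)%E)//.
      by move=> B C mB mC; exact: product_measure2E.
    move/ae_eq_integral_abs => /(_ measurableT (measurableT_comp mNy mL)).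
    by apply: filterS => w /= /(_ I).
  (* [N] in the coordinates of the disintegration, with the component in [TA] left free. *)
  pose N' : set (TL * (TZ * TA)) := (fun x => (x.2.1, x.1)) @^-1` N.
  have mN' : measurable N'.
    apply: measurable_preimage => //; apply: measurable_fun_pair => //.
    exact: measurableT_comp.
  rewrite -[LHS]/(P ((fun w => (L w, (Z w, A w))) @^-1` N')).
  rewrite (cond_law_xsection mL mZA kP mN').
  rewrite (_ : 0%E = \int[P]_w cst 0%E w)%E; last by rewrite integral_cst// mul0e.
  apply: ae_eq_integral => //.
    apply: (measurableT_comp (f := fun x => k x (xsection N' x))) => //.
    by apply: measurable_fun_xsection_finite_kernel; rewrite inE.
  apply: filterS aeN => w Nw _ /=.
  rewrite -(knu w _ _ Nw); last exact: measurable_ysection.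
  congr (k (L w) _); apply/seteqP; split => [[z a]|[z a] []] /=.
    by move/xsectionP => /=; split => //; exact/ysectionP.
  by move/ysectionP => Nz _; exact/xsectionP.
have [f [f0 ffin fint fE]] :=
  @radon_nikodym_sigma_finite _ _ _ nuPL PZL dom.
have mf : measurable_fun setT f := measurable_int _ fint.
have mrho : measurable_fun setT (fun x => fine (f x)) by exact: measurableT_comp.
exists (fun x => fine (f x)); split=> // [x|B mB]; first exact: fine_ge0.
rewrite -[LHS]/(PZL B) fE// integral_mkcond [RHS]integral_mkcond.
have mfB : measurable_fun setT (f \_ B).
  by apply/(measurable_restrictT _ _).1 => //; exact: measurable_funTS.
have fB0 x : (0 <= (f \_ B) x)%E by rewrite patchE; case: ifP.
pose X2 (x : TZ * Omega) := (x.1, L x.2).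
have mX2 : measurable_fun setT X2.
  by apply: measurable_fun_pair => //; exact: measurableT_comp.
have mh : measurable_fun setT
    ((fun x => (fine (f (X2 x)))%:E) \_ (X2 @^-1` B)).
  apply/(measurable_restrictT _ _).1; first exact: measurable_preimage.
  by apply/measurable_funTS/measurable_EFinP; exact: measurableT_comp mrho mX2.
have h0 x : (0 <= ((fun x => (fine (f (X2 x)))%:E) \_ (X2 @^-1` B)) x)%E.
  by rewrite patchE; case: ifP => // _; rewrite lee_fin fine_ge0.
rewrite [LHS](fubini_tonelli1 (f \_ B))// [RHS](fubini_tonelli1 _ mh h0).
apply: eq_integral => z _; rewrite /fubini_F.
rewrite (@ge0_integral_distribution _ _ _ _ _ P mfL (fun l => (f \_ B) (z, l)))//.
  apply: eq_integral => w _ /=; rewrite !patchE.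
  rewrite (_ : ((z, w) \in X2 @^-1` B) = ((z, L w) \in B)).
    by case: ifP => // _; rewrite fineK.
  by apply/idP/idP; rewrite !inE.
exact: measurableT_comp.
Qed.

Section density_transfer.
Context dU (TU : measurableType dU) (U : Omega -> TU).
Hypothesis mU : measurable_fun setT U.
Hypothesis ZUL : cond_indep P Z U L.
Variable rho : TZ * TL -> R.
Hypotheses (mrho : measurable_fun setT rho) (rho0 : forall x, 0 <= rho x).
(* rho is a density of the law of (Z, L); by conditional independence it is also
   one of the law of (Z, (U, L)) with respect to nu and the law of (U, L). *)
Hypothesis rhoP : forall B, measurable B -> P (ZL @^-1` B) =
  (\int[(nu \x P)%E]_(x in (fun x => (x.1, L x.2)) @^-1` B)
     (rho (x.1, L x.2))%:E)%E.

(** [mass B l] is the candidate for Pr(Z in B | L = l). *)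
Let mass (B : set TZ) l := (\int[nu]_z (\1_B z * rho (z, l))%:E)%E.

Let mass0 B l : (0 <= mass B l)%E.
Proof. by apply: integral_ge0 => z _; rewrite lee_fin mulr_ge0. Qed.

Let mint B : measurable B ->
  measurable_fun setT (fun x : TZ * TL => (\1_B x.1 * rho x)%:E).
Proof.
move=> mB; apply/measurable_EFinP/measurable_funM => //.
exact: measurable_indic_comp.
Qed.

Let mmass B : measurable B -> measurable_fun setT (mass B).
Proof.
move=> mB; apply: (measurable_fun_fubini_tonelli_G _ (mint mB)) => x.
by rewrite lee_fin mulr_ge0.
Qed.

Let rect_mass B (E : set Omega) : measurable B -> measurable E ->
  (\int[(nu \x P)%E]_(x in B `*` E) (rho (x.1, L x.2))%:E =
   \int[P]_(w in E) mass B (L w))%E.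
Proof.
move=> mB mE; rewrite integral_mkcond [RHS]integral_mkcond.
have mX2 : measurable_fun setT (fun x : TZ * Omega => (x.1, L x.2)).
  by apply: measurable_fun_pair => //; exact: measurableT_comp.
rewrite (fubini_tonelli2 _ _ _); last 2 first.
- apply/(measurable_restrictT _ _).1; first exact: measurableX.
  by apply/measurable_funTS/measurable_EFinP; exact: measurableT_comp mrho mX2.
- by move=> x; rewrite patchE; case: ifP => // _; rewrite lee_fin.
apply: eq_integral => w _; rewrite /fubini_G patchE.
case: ifPn => wE.
  apply: eq_integral => z _; rewrite patchE in_setX wE andbT indicE.
  by case: ifP => //= _; rewrite ?mul1r ?mul0r.
by rewrite integral0_eq// => z _; rewrite patchE in_setX (negbTE wE) andbF.
Qed.

(** By the hypothesis on [rho], the mass of [B1] is a version of Pr(Z in B1 | L); by conditional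
    independence it is also one of Pr(Z in B1 | U, L). It remains to integrate it over the event
    that (U, L) lies in [S]. *)
Lemma cond_density_rect B1 (S : set (TU * TL)) : measurable B1 -> measurable S ->
  P ((fun w => (Z w, (U w, L w))) @^-1` (B1 `*` S)) =
  (\int[(nu \x P)%E]_(x in (fun x => (x.1, (U x.2, L x.2))) @^-1` (B1 `*` S))
     (rho (x.1, L x.2))%:E)%E.
Proof.
move=> mB1 mS; pose UL w := (U w, L w).
have mUL : measurable_fun setT UL by exact: measurable_fun_pair.
have massL B2 : measurable B2 ->
    (\int[P]_(w in L @^-1` B2) mass B1 (L w) = P (Z @^-1` B1 `&` L @^-1` B2))%E.
  move=> mB2; rewrite -rect_mass//; last exact: measurable_preimage.
  by rewrite -[RHS]/(P (ZL @^-1` (B1 `*` B2))) rhoP//; exact: measurableX.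
(* The mass is known to be finite only for almost every value of [L]; [p] below is its real-valued
   version. *)
have massfin : {ae P, forall w, mass B1 (L w) \is a fin_num}.
  have : P.-integrable setT (mass B1 \o L).
    apply/integrableP; split; first by apply: measurableT_comp => //; exact: mmass.
    under eq_integral do rewrite /= gee0_abs ?mass0//.
    rewrite -[X in integral _ X](preimage_setT L) massL//.
    rewrite (le_lt_trans (probability_le1 _ _)) ?ltry//.
    by apply: measurableI; exact: measurable_preimage.
  by move/integrable_ae => /(_ measurableT); apply: filterS => w /(_ I).
pose p l := fine (mass B1 l).
have mp : measurable_fun setT p by apply: measurableT_comp => //; exact: mmass.
have pE : {ae P, forall w, mass B1 (L w) = (p (L w))%:E}.
  by apply: filterS massfin => w; rewrite /p => /fineK ->.
have pL (E : set Omega) : measurable E ->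
    (\int[P]_(w in E) (p (L w))%:E = \int[P]_(w in E) mass B1 (L w))%E.
  move=> mE; apply: ae_eq_integral => //.
  - by apply/measurable_funTS/measurable_EFinP; exact: measurableT_comp.
  - by apply/measurable_funTS/measurableT_comp => //; exact: mmass.
  - by apply: filterS pE => w ->.
have hp : is_condE P L (\1_(Z @^-1` B1)) p.
  have mZB := measurable_preimage mZ mB1.
  split=> //.
  - exact: integrable_indic.
  - apply/integrableP; split; first by apply/measurable_EFinP; exact: measurableT_comp.
    under eq_integral do rewrite /= ger0_norm ?fine_ge0//.
    rewrite pL// -[X in integral _ X](preimage_setT L) massL//.
    rewrite (le_lt_trans (probability_le1 _ _)) ?ltry//.
    by apply: measurableI => //; exact: measurable_preimage.
  - move=> B mB; have mLB := measurable_preimage mL mB.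
    by rewrite integral_indic// pL// massL.
have [_ _ ipL _] := hp.
have [_ _ _ /(_ S mS) pUL] : is_condE P UL (fun w => \1_B1 (Z w)) (p \o snd).
  apply: condE0_is_condE => //; first exact: measurableT_comp.
  exact: (cond_indep_indic mL mZ mU ZUL mB1 hp).
have mULS := measurable_preimage mUL mS.
have <- : P (UL @^-1` S `&` Z @^-1` B1) =
    P ((fun w => (Z w, (U w, L w))) @^-1` (B1 `*` S)).
  by rewrite setIC.
have mZB := measurable_preimage mZ mB1.
rewrite setIC -integral_indic//; apply: etrans; first exact: pUL.
rewrite (pL _ mULS); apply/esym; exact: (rect_mass mB1 mULS).
Qed.

(** The density 1 under [P] and the density [rho] under the product of [nu] and [P] have the same
    image in the space of (Z, (U, L)): this holds on rectangles by the previous lemma, hence on all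
    measurable sets. *)
Lemma cond_density_integral (F : TZ * (TU * TL) -> R) :
  measurable_fun setT F ->
  P.-integrable setT (EFin \o (fun w => F (Z w, (U w, L w)))) ->
  (nu \x P)%E.-integrable setT
    (EFin \o (fun x => F (x.1, (U x.2, L x.2)) * rho (x.1, L x.2))) /\
  (\int[P]_w (F (Z w, (U w, L w)))%:E = \int[(nu \x P)%E]_x
    (F (x.1, (U x.2, L x.2)) * rho (x.1, L x.2))%:E)%E.
Proof.
move=> mF iF.
pose X1 w := (Z w, (U w, L w)).
pose X2 (x : TZ * Omega) := (x.1, (U x.2, L x.2)).
pose rho2 (x : TZ * Omega) := rho (x.1, L x.2).
have mX1 : measurable_fun setT X1.
  by apply: measurable_fun_pair => //; exact: measurable_fun_pair.
have mX2 : measurable_fun setT X2.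
  apply: measurable_fun_pair => //.
  by apply: measurable_fun_pair; exact: measurableT_comp.
have mrho2 : measurable_fun setT rho2.
  apply: (measurableT_comp mrho); apply: measurable_fun_pair => //.
  exact: measurableT_comp.
have eq12 : forall B, measurable B ->
    (\int[P]_(x in X1 @^-1` B) (cst (1 : R) x)%:E =
     \int[(nu \x P)%E]_(x in X2 @^-1` B) (rho2 x)%:E)%E.
  apply: ge0_integral_rect => //.
  - by move=> x; exact: rho0.
  - have := integral_cst P measurableT 1%E => /= ->.
    by rewrite mul1e [X in (X < _)%E]probability_setT ltry.
  - move=> B S mB mS; rewrite -cond_density_rect//.
    have mBS : measurable (X1 @^-1` (B `*` S)).
      by apply: measurable_preimage => //; exact: measurableX.
    by have := integral_cst P mBS 1%E; rewrite mul1e.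
have iF1 : P.-integrable setT (EFin \o (fun w => F (X1 w) * cst 1 w)).
  by move: iF; congr (integrable _ _ _); apply/funext => w /=; rewrite mulr1.
have [iF2 F12] := integral_comp_eq mX1 mX2 (measurable_cst _) mrho2
  (fun=> ler01) (fun x => rho0 _) eq12 mF iF1.
split; first exact: iF2.
rewrite -[RHS]F12; apply: eq_integral => w _ /=; rewrite mulr1//.
Qed.
End density_transfer.
End density.

(** * The structural equation *)

Section uncorrelated.
Context d dT dS dU (Omega : measurableType d) (TZ : measurableType dT)
  (TL : measurableType dS) (TU : measurableType dU) (R : realType).
Variables (P : probability Omega R) (Z : Omega -> TZ) (L : Omega -> TL)
  (U : Omega -> TU).
Hypotheses (mZ : measurable_fun setT Z) (mL : measurable_fun setT L)
  (mU : measurable_fun setT U).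

Lemma is_condE_integral d' (T : measurableType d') (X : Omega -> T)
    (V : Omega -> R) g : is_condE P X V g ->
  (\int[P]_w (V w)%:E = \int[P]_w (g (X w))%:E)%E.
Proof. by move=> [_ _ _ /(_ setT measurableT)]; rewrite preimage_setT. Qed.

(** This passes from fixed z to the random [Z]. The integrals over [B] of [delta * q] and [b * q]
    become integrals over the product of [nu] and [P]. By Fubini they may be compared at almost
    every z, where the last hypothesis applies after pulling out a weight that depends on [L]
    only. *)
Lemma condE0_uncorrelated (nu : {sigma_finite_measure set TZ -> \bar R})
    (rho : TZ * TL -> R) (calZ : set TZ)
    (q : TZ * (TU * TL) -> R) (delta : TU * TL -> R) (b : TL -> R) :
  cond_indep P Z U L ->
  measurable_fun setT rho -> (forall x, 0 <= rho x) ->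
  (forall B, measurable B -> P ((fun w => (Z w, L w)) @^-1` B) =
    (\int[(nu \x P)%E]_(x in (fun x => (x.1, L x.2)) @^-1` B)
       (rho (x.1, L x.2))%:E)%E) ->
  measurable calZ -> (forall w, calZ (Z w)) ->
  measurable_fun setT q -> measurable_fun setT delta -> measurable_fun setT b ->
  P.-integrable setT (EFin \o (fun w => delta (U w, L w) * q (Z w, (U w, L w)))) ->
  P.-integrable setT (EFin \o (fun w => b (L w) * q (Z w, (U w, L w)))) ->
  (forall z, calZ z -> exists qz dz : TL -> R,
    [/\ is_condE P L (fun w => q (z, (U w, L w))) qz,
        is_condE P L (fun w => delta (U w, L w) * q (z, (U w, L w))) dz &
        {ae P, forall w, dz (L w) = b (L w) * qz (L w)}]) ->
  condE0 P (fun w => (Z w, L w))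
    (fun w => (delta (U w, L w) - b (L w)) * q (Z w, (U w, L w))).
Proof.
move=> ZUL mrho rho0 rhoP mcalZ ZcalZ mq mdelta mb idq ibq unc; split.
  have := integrableBr idq ibq; congr (integrable _ _ _).
  by apply/funext => w /=; congr EFin; ring.
move=> B mB; rewrite integral_preimage.
(* The factor for [calZ] equals 1 along [Z]; under [nu] it discards the z about which the hypothesis
   says nothing. *)
pose s (x : TZ * TL) : R := \1_calZ x.1 * \1_B x.
have ms : measurable_fun setT s.
  by apply: measurable_funM; [exact: measurable_indic_comp|exact: measurable_indic].
have sZL w : s (Z w, L w) = \1_B (Z w, L w).
  by rewrite /s/= indicE mem_set// mul1r.
have mZL : measurable_fun setT (fun x : TZ * (TU * TL) => (x.1, x.2.2)).
  by apply: measurable_fun_pair => //; exact: measurableT_comp.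
have m22 : measurable_fun setT (fun x : TZ * (TU * TL) => x.2.2).
  exact: measurableT_comp.
pose F1 (x : TZ * (TU * TL)) := s (x.1, x.2.2) * (delta x.2 * q x).
pose F2 (x : TZ * (TU * TL)) := s (x.1, x.2.2) * (b x.2.2 * q x).
have mF1 : measurable_fun setT F1.
  apply: measurable_funM; first exact: (measurableT_comp ms mZL).
  by apply: measurable_funM => //; exact: measurableT_comp.
have mF2 : measurable_fun setT F2.
  apply: measurable_funM; first exact: (measurableT_comp ms mZL).
  by apply: measurable_funM => //; exact: (measurableT_comp mb m22).
pose ZUL' w := (Z w, (U w, L w)).
have mZUL' : measurable_fun setT ZUL'.
  by apply: measurable_fun_pair => //; exact: measurable_fun_pair.
have msZL : measurable_fun setT (fun w => s (Z w, L w)).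
  by apply: (measurableT_comp ms); exact: measurable_fun_pair.
have bsZL : exists M : R, {ae P, forall w, `|s (Z w, L w)| <= M}.
  by exists 1; apply: nearW => w; rewrite sZL indic_bounded.
have iF1 : P.-integrable setT (EFin \o (fun w => F1 (ZUL' w))).
  exact: integrable_boundedM idq msZL bsZL.
have iF2 : P.-integrable setT (EFin \o (fun w => F2 (ZUL' w))).
  exact: integrable_boundedM ibq msZL bsZL.
have [j1 e1] := cond_density_integral mZ mL mU ZUL mrho rho0 rhoP mF1 iF1.
have [j2 e2] := cond_density_integral mZ mL mU ZUL mrho rho0 rhoP mF2 iF2.
transitivity (\int[P]_w ((F1 (ZUL' w))%:E - (F2 (ZUL' w))%:E))%E.
  by apply: eq_integral => w _; rewrite -EFinB /F1 /F2/= sZL; congr EFin; ring.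
rewrite integralB_EFin//.
suff -> : (\int[P]_w (F1 (ZUL' w))%:E = \int[P]_w (F2 (ZUL' w))%:E)%E.
  by rewrite subee// integrable_fin_num.
rewrite e1 e2 -(integral12_prod_meas1 j1) -(integral12_prod_meas1 j2).
apply: ae_eq_integral => //; [exact: measurable_fubini_F j1|exact: measurable_fubini_F j2|].
move: (ae_integrable1 j1) (ae_integrable1 j2); apply: filterS2 => z i1 i2 _.
rewrite /fubini_F/=; have [zcal|zcal] := pselect (calZ z); last first.
  have s0 l : s (z, l) = 0 by rewrite /s/= indicE memNset// mul0r.
  by apply: eq_integral => w _; rewrite /F1 /F2/= s0 !mul0r.
(* b(L) q(z, (U, L)) need not be integrable for an individual z, but it is for
   almost all z once multiplied by rho(z, L). *)
have [qz [dz [hq hd qd]]] := unc z zcal.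
pose sz l := s (z, l) * rho (z, l).
have msz : measurable_fun setT sz.
  have mz : measurable_fun setT (fun l : TL => (z, l)) by exact: measurable_fun_pair.
  by apply: measurable_funM; [exact: (measurableT_comp ms mz)|exact: (measurableT_comp mrho mz)].
have h1 := is_condE_pullout mL hd msz.
have h2 := is_condE_pullout mL hq (measurable_funM msz mb).
transitivity (\int[P]_w (sz (L w) * (delta (U w, L w) * q (z, (U w, L w))))%:E)%E.
  by apply: eq_integral => w _; rewrite /F1 /sz/=; congr EFin; ring.
transitivity (\int[P]_w (sz (L w) * b (L w) * q (z, (U w, L w)))%:E)%E; last first.
  by apply: eq_integral => w _; rewrite /F2 /sz/=; congr EFin; ring.
rewrite (is_condE_integral (h1 _)); last first.
  move: i1; congr (integrable _ _ _); apply/funext => w.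
  by rewrite /F1 /sz/=; congr EFin; ring.
rewrite (is_condE_integral (h2 _)); last first.
  move: i2; congr (integrable _ _ _); apply/funext => w.
  by rewrite /F2 /sz/=; congr EFin; ring.
apply: ae_eq_integral => //.
- apply/measurable_EFinP; apply: (measurableT_comp (f := fun l => sz l * dz l)) => //.
  by apply: measurable_funM => //; case: hd.
- apply/measurable_EFinP.
  apply: (measurableT_comp (f := fun l => sz l * b l * qz l)) => //.
  by apply: measurable_funM; [exact: measurable_funM|case: hq].
- by apply: filterS qd => w -> _; rewrite mulrA.
Qed.
End uncorrelated.

(** * Decomposition of the outcome residual *)

Section additive_structural_equation.
Context (R : realType) d dU dZ dL (Omega : measurableType d)
  (TU : measurableType dU) (TZ : measurableType dZ) (TL : measurableType dL).
Variables (P : probability Omega R) (calZ : set TZ) (calL : set TL).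
Variables (A : Omega -> bool) (Z : Omega -> TZ) (L : Omega -> TL)
  (U : Omega -> TU) (Y : Omega -> R) (Ya : bool -> Omega -> R).
Hypotheses (mcalZ : measurable calZ) (mA : measurable_fun setT A)
  (mZ : measurable_fun setT Z) (mL : measurable_fun setT L)
  (mU : measurable_fun setT U) (mY : measurable_fun setT Y).
Hypotheses (ZcalZ : forall w, calZ (Z w)) (LcalL : forall w, calL (L w)).
Hypothesis Ya_int : forall a, P.-integrable setT (EFin \o Ya a).
Variable k : R.-pker TL ~> (TZ * bool)%type.
Hypotheses (k_law : is_cond_law P L (fun w => (Z w, A w)) k)
  (k_dom : cond_dominated calL k).
Hypothesis consistency : {ae P, forall w, Y w = Ya (A w) w}.
Hypothesis latent_ignorability : forall a,
  cond_indep P (Ya a) (fun w => (A w, Z w)) (fun w => (U w, L w)).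
Hypothesis iv_independence : cond_indep P Z U L.
Variables (muA : TZ * (TU * TL) -> R) (mA_UL : TU * TL -> R).
Hypotheses
  (muAP : is_condE P (fun w => (Z w, (U w, L w))) (fun w => (A w)%:R) muA)
  (mA_ULP : is_condE P (fun w => (U w, L w)) (fun w => (A w)%:R) mA_UL)
  (uncorrelated : forall z, calZ z ->
     is_condCov P L (Ya true \- Ya false)
       (fun w => muA (z, (U w, L w)) - mA_UL (U w, L w)) (cst 0)).
Variables (delta : TU * TL -> R) (cov : TL -> R) (e : bool -> TL -> R).
Hypotheses
  (deltaP : is_condE P (fun w => (U w, L w)) (Ya true \- Ya false) delta)
  (covP : is_condCov P L (fun w => delta (U w, L w))
            (fun w => mA_UL (U w, L w)) cov)
  (eP : forall a, is_condE P L (Ya a) (e a)).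

Let UL w := (U w, L w).
Let ZUL w := (Z w, UL w).
Let AZUL w := ((A w, Z w), UL w).
Let ZL w := (Z w, L w).
Let b l := e true l - e false l.
Let a w : R := (A w)%:R.
Let D := Ya true \- Ya false.

Let mUL : measurable_fun setT UL. Proof. exact: measurable_fun_pair. Qed.
Let mZUL : measurable_fun setT ZUL. Proof. exact: measurable_fun_pair. Qed.
Let mZL : measurable_fun setT ZL. Proof. exact: measurable_fun_pair. Qed.
Let mAZ : measurable_fun setT (fun w => (A w, Z w)).
Proof. exact: measurable_fun_pair. Qed.
Let mAZUL : measurable_fun setT AZUL.
Proof. exact: measurable_fun_pair. Qed.
Let mbool : measurable_fun setT (fun x : bool => x%:R : R).
Proof. by []. Qed.
Let ma : measurable_fun setT a.
Proof. exact: measurableT_comp mbool mA. Qed.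
Let a01 w : 0 <= a w <= 1.
Proof. by rewrite /a; case: (A w); rewrite lexx ler01. Qed.

Let norm01 V : {ae P, forall w, 0 <= V w <= 1} ->
  exists M : R, {ae P, forall w, `|V w| <= M}.
Proof.
by move=> V01; exists 1; apply: filterS V01 => w /andP[V0 V1]; rewrite ger0_norm.
Qed.

Let ba : exists M : R, {ae P, forall w, `|a w| <= M}.
Proof. by apply: norm01; apply: nearW. Qed.
Let bmuA : exists M : R, {ae P, forall w, `|muA (ZUL w)| <= M}.
Proof. exact/norm01/(is_condE_itv01 mZUL muAP). Qed.
Let bm : exists M : R, {ae P, forall w, `|mA_UL (UL w)| <= M}.
Proof. exact/norm01/(is_condE_itv01 mUL mA_ULP). Qed.

Let mmuA : measurable_fun setT muA. Proof. by case: muAP. Qed.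
Let mm : measurable_fun setT mA_UL. Proof. by case: mA_ULP. Qed.
Let mdelta : measurable_fun setT delta. Proof. by case: deltaP. Qed.
Let me x : measurable_fun setT (e x). Proof. by case: (eP x). Qed.
Let mb : measurable_fun setT b. Proof. exact: measurable_funB. Qed.

Let ZL_ZUL V : condE0 P ZUL V -> condE0 P ZL V.
Proof.
have mp : measurable_fun setT (fun x : TZ * (TU * TL) => (x.1, x.2.2)).
  by apply: measurable_fun_pair => //; exact: measurableT_comp.
exact: (condE0_comp mp).
Qed.

Let ZUL_AZUL V : condE0 P AZUL V -> condE0 P ZUL V.
Proof.
have mp : measurable_fun setT (fun x : (bool * TZ) * (TU * TL) => (x.1.2, x.2)).
  by apply: measurable_fun_pair => //; exact: measurableT_comp.
exact: (condE0_comp mp).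
Qed.

Let idelta : P.-integrable setT (EFin \o (delta \o UL)).
Proof. by case: deltaP. Qed.
Let ib : P.-integrable setT (EFin \o (b \o L)).
Proof.
by apply: integrableBr; [case: (eP true)|case: (eP false)].
Qed.

Let bP : is_condE P L D b.
Proof.
apply: condE0_is_condE => //.
have := condE0B mL (is_condE_condE0 mL (eP true)) (is_condE_condE0 mL (eP false)).
by congr (condE0 _ _ _); apply/funext => w; rewrite /b /D/=; ring.
Qed.

Let deltaL : is_condE P L (delta \o UL) b.
Proof. exact (is_condE_tower mUL measurable_snd deltaP bP). Qed.

(** Ignorability concerns each potential outcome separately, so [D] is treated through the
    regressions [h1] and [h0] of the two arms, whose difference is [delta] almost surely. Being a
    function of the conditioning variable, [a] factors out. *)
Let cond_treatment : condE0 P AZUL (fun w => a w * (D w - delta (UL w))).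
Proof.
have [h0 h0P] := is_condE_exists mUL (Ya_int false).
have [h1 h1P] := is_condE_exists mUL (Ya_int true).
have cYa x h : is_condE P UL (Ya x) h ->
    condE0 P AZUL (fun w => Ya x w - h (UL w)).
  move=> hP; apply: (cond_indep_condE mUL (F := fst)) => //.
  exact/integrable_measurable/Ya_int.
have mD : measurable_fun setT D.
  by have [_ iD _ _] := bP; exact: integrable_measurable iD.
have mDd : measurable_fun setT (fun w => D w - delta (UL w)).
  by apply: measurable_funB => //; exact: measurableT_comp.
have hD : is_condE P UL D (fun x => h1 x - h0 x).
  have [mh0 _ ih0 _] := h0P; have [mh1 _ ih1 _] := h1P.
  apply: condE0_is_condE => //.
  - exact: measurable_funB.
  - exact: (integrableBr ih1 ih0).
  - have := condE0B mUL (is_condE_condE0 mUL h1P) (is_condE_condE0 mUL h0P).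
    by congr (condE0 _ _ _); apply/funext => w; rewrite /D/=; ring.
have cD : condE0 P AZUL (fun w => D w - delta (UL w)).
  apply: condE0_ae (condE0B mAZUL (cYa _ _ h1P) (cYa _ _ h0P)) mDd _ => //.
  apply: filterS (is_condE_unique mUL deltaP hD (nearW _ (fun=> erefl))) => w ->.
  by rewrite /D/=; ring.
have m11 : measurable_fun setT (fun x : (bool * TZ) * (TU * TL) => x.1.1%:R : R).
  by apply: (measurableT_comp mbool); exact: measurableT_comp.
exact: (condE0M mAZUL m11 cD (integrable_boundedM cD.1 ma ba)).
Qed.

(** The regression [h0] on (U, L) is inserted: ignorability centres Y(0) - h0(U, L), and the
    independence of Z and U given L centres h0(U, L) - E[Y(0) | L]. *)
Let cond_baseline : condE0 P ZL (fun w => Ya false w - e false (L w)).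
Proof.
have [h0 h0P] := is_condE_exists mUL (Ya_int false).
have c1 : condE0 P ZL (fun w => Ya false w - h0 (UL w)).
  apply/ZL_ZUL/ZUL_AZUL/(cond_indep_condE mUL (F := fst)) => //.
  exact/integrable_measurable/Ya_int.
have c2 : condE0 P ZL (fun w => h0 (UL w) - e false (L w)).
  apply: (cond_indep_condE mL mU mZ (cond_indep_sym iv_independence)).
    by case: h0P.
  exact (is_condE_tower mUL measurable_snd h0P (eP false)).
have := condE0D mZL c1 c2.
by congr (condE0 _ _ _); apply/funext => w; ring.
Qed.

Let cond_residual (phi : TU * TL -> R) : measurable_fun setT phi ->
  P.-integrable setT (EFin \o (phi \o UL)) ->
  condE0 P ZL (fun w => phi (UL w) * (a w - muA (ZUL w))).
Proof.
move=> mphi iphi; apply: ZL_ZUL.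
have mphi2 : measurable_fun setT (fun x : TZ * (TU * TL) => phi x.2).
  exact: measurableT_comp.
apply: (condE0M mZUL mphi2 (is_condE_condE0 mZUL muAP)).
have mmZ : measurable_fun setT (muA \o ZUL) by exact: measurableT_comp.
have := integrableBr (integrable_boundedM iphi ma ba)
  (integrable_boundedM iphi mmZ bmuA).
by congr (integrable _ _ _); apply/funext => w /=; congr EFin; ring.
Qed.

(** The product depends on (U, L) only, so its regression on (Z, L) is its regression on [L]. This
    is E[delta m | L] - b E[m | L] with m standing for [mA_UL], and it is the covariance because
    [delta] has regression [b] on [L]. *)
Let cond_covariance :
  condE0 P ZL (fun w => (delta (UL w) - b (L w)) * mA_UL (UL w) - cov (L w)).
Proof.
have [mcov [eV [eW [eVW [hV hW hVW covE]]]]] := covP.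
have mmL : measurable_fun setT (mA_UL \o UL) by exact: measurableT_comp.
have ibm : P.-integrable setT (EFin \o (fun w => b (L w) * mA_UL (UL w))).
  have := integrable_boundedM ib mmL bm; congr (integrable _ _ _).
  by apply/funext => w /=; rewrite mulrC.
have hbW := is_condE_pullout mL hW mb ibm.
pose F (x : TU * TL) := (delta x - b x.2) * mA_UL x.
have mF : measurable_fun setT F.
  apply: measurable_funM => //; apply: measurable_funB => //.
  exact: measurableT_comp.
have hF : is_condE P L (fun w => F (U w, L w)) (fun l => eVW l - b l * eW l).
  have [mbW _ ibW _] := hbW; have [meVW _ ieVW _] := hVW.
  apply: condE0_is_condE => //.
  - exact: measurable_funB.
  - exact: (integrableBr ieVW ibW).
  - have := condE0B mL (is_condE_condE0 mL hVW) (is_condE_condE0 mL hbW).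
    by congr (condE0 _ _ _); apply/funext => w; rewrite /F/=; ring.
have := cond_indep_condE mL mU mZ (cond_indep_sym iv_independence) mF hF.
move=> /condE0_ae; apply=> //.
  apply: measurable_funB; last exact: measurableT_comp.
  exact: (measurableT_comp mF mUL).
have Vb : {ae P, forall w, eV (L w) = b (L w)}.
  exact: is_condE_unique mL hV deltaL (nearW _ (fun=> erefl)).
by move: covE Vb; apply: filterS2 => w -> ->.
Qed.

Let cond_effect : condE0 P ZL
  (fun w => (delta (UL w) - b (L w)) * (muA (ZUL w) - mA_UL (UL w))).
Proof.
have [nu nuP] := k_dom.
have [rho [mrho rho0 rhoP]] : exists rho : TZ * TL -> R,
    [/\ measurable_fun setT rho, forall x, 0 <= rho x &
        forall B, measurable B -> P (ZL @^-1` B) =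
          (\int[(nu \x P)%E]_(x in (fun x => (x.1, L x.2)) @^-1` B)
            (rho (x.1, L x.2))%:E)%E].
  by apply: (cond_dominated_density mZ mL mA k_law) => w B; exact: nuP.
pose q (x : TZ * (TU * TL)) := muA x - mA_UL x.2.
have mq : measurable_fun setT q.
  by apply: measurable_funB => //; exact: measurableT_comp.
have iq V : P.-integrable setT (EFin \o V) ->
    P.-integrable setT (EFin \o (fun w => V w * q (ZUL w))).
  move=> iV; have mmZ : measurable_fun setT (muA \o ZUL) by exact: measurableT_comp.
  have mmL : measurable_fun setT (mA_UL \o UL) by exact: measurableT_comp.
  have := integrableBr (integrable_boundedM iV mmZ bmuA)
    (integrable_boundedM iV mmL bm).
  by congr (integrable _ _ _); apply/funext => w /=; congr EFin; rewrite /q/=; ring.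
apply: (condE0_uncorrelated mZ mL mU iv_independence mrho rho0 rhoP mcalZ ZcalZ
  mq mdelta mb (iq _ idelta) (iq _ ib)) => z zcal.
have [_ [eV [eW [eVW [hV hW hVW uncE]]]]] := uncorrelated zcal.
(* A zero covariance says that [eVW] is [eV * eW], and [eV] is [b] almost surely. *)
exists eW, eVW; split=> //.
  (* The assumption is about [D]. For fixed z the other factor is a function of (U, L), so by the
     tower property [D] may be replaced by its regression [delta]. *)
  pose qz x := q (z, x).
  have mqz : measurable_fun setT qz.
    by apply: (measurableT_comp mq); exact: measurable_fun_pair.
  have iqD : P.-integrable setT (EFin \o (fun w => qz (UL w) * D w)).
    have [_ + _ _] := hVW; congr (integrable _ _ _).
    by apply/funext => w; rewrite /= mulrC.
  have hD := is_condE_pullout mUL deltaP mqz iqD.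
  have hVW' : is_condE P L (fun w => qz (UL w) * D w) eVW.
    by move: hVW; congr (is_condE _ _ _ _); apply/funext => w; rewrite /= mulrC.
  have := is_condE_tower mUL measurable_snd hD hVW'.
  by congr (is_condE _ _ _ _); apply/funext => w; rewrite /= mulrC.
have Vb : {ae P, forall w, eV (L w) = b (L w)}.
  exact: is_condE_unique mL hV bP (nearW _ (fun=> erefl)).
by move: uncE Vb; apply: filterS2 => w /esym/eqP + <-; rewrite subr_eq0 => /eqP.
Qed.

(* The residual Y - f(A, L) is the sum of Y(0) - E[Y(0) | L], A (D - delta),
   delta (A - muA), (delta - b) (muA - mA_UL), (delta - b) mA_UL - cov and
   - b (A - muA), each of conditional mean zero given (Z, L). *)
Lemma structural_equation :
  condE0 P ZL (fun w => Y w - (cov (L w) + e (A w) (L w))).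
Proof.
have cb := cond_residual (measurableT_comp mb measurable_snd) ib.
have := condE0B mZL (condE0D mZL (condE0D mZL (condE0D mZL (condE0D mZL
  cond_baseline (ZL_ZUL (ZUL_AZUL cond_treatment)))
  (cond_residual mdelta idelta)) cond_effect) cond_covariance) cb.
move=> /condE0_ae; apply=> //.
  have [mcov _] := covP; apply: measurable_funB => //; apply: measurable_funD.
    exact: measurableT_comp.
  have -> : (fun w => e (A w) (L w)) = fun w => e false (L w) + a w * b (L w).
    by apply/funext => w; rewrite /a /b; case: (A w) => /=; ring.
  apply: measurable_funD; first exact: measurableT_comp.
  by apply: measurable_funM => //; exact: measurableT_comp.
apply: filterS consistency => w ->; rewrite /a /D /b /=.
by case: (A w) => /=; ring.
Qed.

End additive_structural_equation.

(** * Uniqueness *)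

Section rational_orthants.
Context (R : realType) (n : nat).

(* A pi-system indexed by a countable type, containing the whole space. *)
Definition rational_orthant (s : seq ('I_n * rat)) : set (n.-tuple R) :=
  [set t | all (fun iq => tnth t iq.1 <= ratr iq.2) s].

Lemma setI_rational_orthant s1 s2 :
  rational_orthant s1 `&` rational_orthant s2 = rational_orthant (s1 ++ s2).
Proof.
by apply/seteqP; split=> t; rewrite /rational_orthant/= all_cat => /andP.
Qed.

Lemma measurable_rational_orthant s : measurable (rational_orthant s).
Proof.
elim: s => [|[i q] s ih].
  rewrite (_ : rational_orthant [::] = setT)//.
  by apply/seteqP; split.
rewrite -cat1s -setI_rational_orthant; apply: measurableI => //.
rewrite (_ : rational_orthant _ = (fun t => tnth t i) @^-1` `]-oo, ratr q]%classic).
  by apply: measurable_preimage => //; exact: measurable_tnth.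
by apply/seteqP; split=> t; rewrite /rational_orthant/= in_itv/= andbT.
Qed.

(** For the nontrivial inclusion, the identity out of the generated sigma-algebra is shown
    measurable coordinate by coordinate. *)
Lemma measurable_tuple_generated :
  @measurable _ (n.-tuple R) = <<s range rational_orthant >>.
Proof.
apply/seteqP; split; last first.
  apply: smallest_sub; first exact: sigma_algebra_measurable.
  by move=> _ [s _ <-]; exact: measurable_rational_orthant.
pose T := g_sigma_algebraType (range rational_orthant).
suff mid : measurable_fun (setT : set T) (fun t : T => t : n.-tuple R).
  by move=> B mB; have := mid measurableT B mB; rewrite setTI.
apply/measurable_fun_tnthP => i.
apply: (measurability _ (RGenOInfty.measurableE R)).
move=> _ [_ [x ->] <-]; rewrite setTI.
(* A coordinate exceeds x exactly when it exceeds some rational q with x <= q. *)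
rewrite (_ : _ @^-1` _ = \bigcup_(q : rat)
  (if x <= ratr q then ~` rational_orthant [:: (i, q)] else set0)); last first.
  apply/seteqP; split=> [t|t [q _]] /=.
    rewrite in_itv/= andbT => /rat_in_itvoo[q]; rewrite in_itv/= => /andP[xq qt].
    by exists q => //; rewrite (ltW xq) /rational_orthant/= andbT; apply/negP; rewrite -ltNge.
  rewrite in_itv/= andbT; case: ifP => // xq; rewrite /rational_orthant/= andbT.
  by move/negP; rewrite -ltNge; exact: le_lt_trans.
apply: bigcupT_measurable_rat => q; case: ifP => // _; apply: measurableC.
by apply: sub_sigma_algebra; exists [:: (i, q)].
Qed.

End rational_orthants.

(** * Relevance against a constant treatment regression *)

Section relevance.
Context d (TZ : measurableType d) (R : realType) (I : countType).
Variable G : I -> set TZ.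
Hypotheses (GE : @measurable _ TZ = <<s range G>>)
  (GI : setI_closed (range G)) (GT : exists i, G i = setT).

Let mG i : measurable (G i).
Proof. by rewrite GE; apply: sub_sigma_algebra; exists i. Qed.

(** Proportionality on the pi-system makes the constant [c] a version of the regression of the
    treatment indicator on the instrument. A constant takes no two distinct values, so
    [iv_relevanceP] excludes dependence. *)
Lemma indep_proportional (mu : {measure set (TZ * bool)%type -> \bar R}) (c : R) :
  mu setT = 1%E ->
  (forall i, mu (G i `*` [set true]) = c%:E * mu (G i `*` setT))%E ->
  indep mu fst (fun x : TZ * bool => x.2 == true).
Proof.
move=> mu1 muc.
(* The restriction to the whole space only serves to make mu a probability. *)
have mm1 : mrestr mu measurableT setT = 1%E by rewrite /mrestr setIT.
pose nu : probability (TZ * bool)%type R :=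
  HB.pack_for (probability (TZ * bool)%type R)
    (Measure.sort (mrestr mu measurableT))
    (Measure_isProbability.Build _ _ _ (mrestr mu measurableT) mm1).
have nuE B : nu B = mu B by rewrite /nu/= /mrestr setIT.
suff : indep nu fst (fun x : TZ * bool => x.2 == true).
  by move=> ind B C mB mC; rewrite -!nuE; exact: ind.
have mE : measurable ([set: TZ] `*` [set true]) by exact: measurableX.
pose f (x : TZ * bool) : R := (x.2 == true)%:R.
have fE x : f x = \1_([set: TZ] `*` [set true]) x.
  rewrite indicE /f; congr (_%:R); case: x => z [] /=.
    by rewrite mem_set.
  by rewrite memNset// => -[].
have mfst : measurable_fun setT (@fst TZ bool) by exact: measurable_fst.
have iff_ : nu.-integrable setT (EFin \o f).
  rewrite (_ : EFin \o f = EFin \o \1_([set: TZ] `*` [set true])).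
    exact: integrable_indic.
  by apply/funext => x /=; rewrite fE.
have intf B : measurable B ->
    (\int[nu]_(x in fst @^-1` B) (f x)%:E = mu (B `*` [set true]))%E.
  move=> mB; rewrite -nuE; under eq_integral do rewrite fE.
  rewrite integral_indic//; last exact: measurable_preimage.
  congr (nu _); apply/seteqP; split=> [[z x] [[_ /= ->] ?]//|[z x] [/= ? ->]//].
have intc B : measurable B ->
    (\int[nu]_(x in fst @^-1` B) c%:E = c%:E * mu (B `*` setT))%E.
  move=> mB; have := integral_cst nu (measurable_preimage mfst mB) c%:E.
  move=> /= ->; rewrite -nuE; congr (_ * nu _)%E.
  by apply/seteqP; split=> [[z x] //=|[z x] []//].
have ic : nu.-integrable setT (EFin \o cst c) by exact: finite_measure_integrable_cst.
have U0 i : (\int[nu]_(x in fst @^-1` (G i)) (f x - c)%:E = 0)%E.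
  have mGi := measurable_preimage mfst (mG i).
  have iS W : nu.-integrable setT W -> nu.-integrable (fst @^-1` (G i)) W.
    exact: integrableS.
  have := integralB_EFin mGi (iS _ iff_) (iS _ ic).
  have fin : (c%:E * mu (G i `*` setT))%E \is a fin_num.
    by rewrite -nuE fin_numM// fin_num_measure//; exact: measurableX.
  by rewrite intf// intc// muc subee.
have hc : is_condE nu fst f (cst c).
  apply: condE0_is_condE => //.
  apply: (condE0_generated mfst GE GI); first exact: (integrableBr iff_ ic).
    by have [i Gi] := GT; have := U0 i; rewrite Gi preimage_setT.
  by move=> _ [i _ <-]; exact: U0.
apply: contrapT => nind.
have nuT : nu (setT `*` setT) = 1%E by rewrite setXTT nuE.
have /(_ (cst c) hc) [z0 [z1 [_ _ []]]]// :=
  (iv_relevanceP true measurableT nuT).1 nind.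
Qed.

End relevance.

Lemma cond_law_condE d d1 dT (Omega : measurableType d)
    (T1 : measurableType d1) (T : measurableType dT) (R : realType)
    (P : probability Omega R) (X : Omega -> T) (V : Omega -> T1)
    (k : R.-pker T ~> T1) (B : set T1) :
  measurable_fun setT X -> measurable_fun setT V -> is_cond_law P X V k ->
  measurable B -> is_condE P X (fun w => \1_B (V w)) (fun x => fine (k x B)).
Proof.
move=> mX mV kXV mB.
have k1 x : (k x B <= 1)%E.
  by rewrite -(prob_kernel (s := k) x); apply: le_measure => //; rewrite inE.
have kE x : (fine (k x B))%:E = k x B.
  by rewrite fineK// ge0_fin_numE// (le_lt_trans (k1 x))// ltry.
have mkB : measurable_fun setT (fun x => fine (k x B)).
  by apply: measurableT_comp => //; exact: measurable_kernel.
have mVB := measurable_preimage mV mB.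
split=> //.
- apply: integrable_bounded; first exact: measurable_indic_comp.
  by exists 1; apply: nearW => w; exact: indic_bounded.
- apply: integrable_bounded; first exact: measurableT_comp.
  exists 1; apply: nearW => w; rewrite ger0_norm ?fine_ge0//.
  by rewrite -lee_fin kE.
- move=> C mC; under [RHS]eq_integral do rewrite kE.
  rewrite -(kXV C B mC mB) setIC -(@integral_indic _ _ _ P (X @^-1` C))//.
  exact: measurable_preimage.
Qed.

Section uniqueness.
Context (R : realType) d dZ dL (Omega : measurableType d)
  (TZ : measurableType dZ) (TL : measurableType dL).
Variables (P : probability Omega R) (calL : set TL).
Variables (A : Omega -> bool) (Z : Omega -> TZ) (L : Omega -> TL).
Hypotheses (mA : measurable_fun setT A) (mZ : measurable_fun setT Z)
  (mL : measurable_fun setT L) (LcalL : forall w, calL (L w)).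
Variable k : R.-pker TL ~> (TZ * bool)%type.
Hypotheses (k_law : is_cond_law P L (fun w => (Z w, A w)) k)
  (relevance : iv_relevance calL k).
Variables (I : countType) (G : I -> set TZ).
Hypotheses (GE : @measurable _ TZ = <<s range G>>)
  (GI : setI_closed (range G)) (GT : exists i, G i = setT).
Variable h : bool -> TL -> R.
Hypotheses (mh : forall x, measurable_fun setT (h x))
  (h0 : condE0 P (fun w => (Z w, L w)) (fun w => h (A w) (L w))).

Let mG i : measurable (G i).
Proof. by rewrite GE; apply: sub_sigma_algebra; exists i. Qed.
Let mZA : measurable_fun setT (fun w => (Z w, A w)).
Proof. exact: measurable_fun_pair. Qed.
Let mZL : measurable_fun setT (fun w => (Z w, L w)).
Proof. exact: measurable_fun_pair. Qed.

Let k1 i l := fine (k l (G i `*` [set true])).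
Let kT i l := fine (k l (G i `*` setT)).

(* The functions h are only known to be integrable along A, hence the
   truncation to the event that both are at most m. *)
Let truncated (m : nat) l : bool := (`|h true l| <= m%:R) && (`|h false l| <= m%:R).

(** The centred variable h(A, L) = h(0, L) + (h(1, L) - h(0, L)) I{A = 1} is multiplied by the
    indicators of Z in [G i] and of the truncation, and regressed on [L] alone: the kernel supplies
    the regressions [kT] and [k1]. *)
Let kernel_equation_truncated i m : {ae P, forall w, truncated m (L w) ->
  h false (L w) * kT i (L w) + (h true (L w) - h false (L w)) * k1 i (L w) = 0}.
Proof.
pose cm l : R := (truncated m l)%:R.
have mcm : measurable_fun setT cm.
  have -> : cm = \1_([set l | `|h true l| <= m%:R] `&` [set l | `|h false l| <= m%:R]).
    apply/funext => l; rewrite indicI /cm /truncated/= !indicE -natrM mulnb.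
    by congr ((_ && _)%:R); [apply/idP/idP|apply/idP/idP]; rewrite inE.
  have mle x : measurable [set l | `|h x l| <= m%:R].
    rewrite (_ : [set _ | _] = (fun l => `|h x l|) @^-1` `]-oo, m%:R]%classic).
      by apply: measurable_preimage => //; exact: measurableT_comp.
    by apply/seteqP; split=> l; rewrite /= in_itv.
  by apply: measurable_indic; exact: measurableI.
have cmh x l : `|cm l * h x l| <= m%:R.
  rewrite /cm; case: (boolP (truncated m l)) => [/andP[ht hf]|_].
    by rewrite mul1r; case: x.
  by rewrite mul0r normr0.
have mch x : measurable_fun setT (fun l => cm l * h x l) by exact: measurable_funM.
pose Dm l := cm l * h true l - cm l * h false l.
have mDm : measurable_fun setT Dm by exact: measurable_funB.
pose phi (x : TZ * TL) := \1_(G i) x.1 * cm x.2.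
have mphi : measurable_fun setT phi.
  apply: measurable_funM; first exact: measurable_indic_comp.
  exact: measurableT_comp.
have bddL (g : TL -> R) (B : set (TZ * bool)) : measurable_fun setT g -> measurable B ->
    (exists M : R, forall l, `|g l| <= M) ->
    is_condE P L (fun w => g (L w) * \1_B (Z w, A w))
      (fun l => g l * fine (k l B)).
  move=> mg mB [M gM]; apply: is_condE_pullout => //.
    exact: (cond_law_condE mL mZA k_law mB).
  apply: integrable_bounded.
    by apply: measurable_funM; [exact: measurableT_comp|exact: measurable_indic_comp].
  exists M; apply: nearW => w; rewrite normrM (le_trans _ (gM (L w)))//.
  by rewrite ler_piMr// indic_bounded.
have mBi (S : set bool) : measurable (G i `*` S) by exact: measurableX.
have bDm : exists M : R, forall l, `|Dm l| <= M.
  by exists (m%:R + m%:R) => l; rewrite (le_trans (ler_normB _ _))// lerD.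
have bch : exists M : R, forall l, `|cm l * h false l| <= M by exists m%:R.
have e1 := bddL _ _ mDm (mBi [set true]) bDm.
have eT := bddL _ _ (mch false) (mBi setT) bch.
have c0 : condE0 P L (fun w => phi (Z w, L w) * h (A w) (L w)).
  apply: (condE0_comp (X := fun w => (Z w, L w)) (p := snd)) => //.
  apply: condE0M => //.
  have [ih _] := h0.
  apply: integrable_bounded.
    apply: measurable_funM; first exact: measurableT_comp.
    exact: integrable_measurable ih.
  exists m%:R; apply: nearW => w; rewrite /phi/= -mulrA normrM.
  by rewrite (le_trans _ (cmh (A w) (L w)))// ler_piMl// indic_bounded.
have ceq := condE0B mL (condE0B mL c0 (is_condE_condE0 mL e1)) (is_condE_condE0 mL eT).
pose g l := cm l * h false l * kT i l + Dm l * k1 i l.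
have mkB B : measurable B -> measurable_fun setT (fun l => fine (k l B)).
  by move=> mB; apply: measurableT_comp => //; exact: measurable_kernel.
have mg : measurable_fun setT g.
  apply: measurable_funD; apply: measurable_funM => //.
    by apply: mkB; exact: measurableX.
  by apply: mkB; exact: measurableX.
have cg : condE0 P L (g \o L).
  move: ceq => /condE0_ae; apply=> //; first exact: measurableT_comp.
  apply: nearW => w; rewrite /g /phi /Dm /k1 /kT/= !indicE !in_setX !in_setT /=.
  rewrite (_ : (A w \in [set true]) = A w); last first.
    by apply/idP/idP; rewrite inE.
  by case: (A w); case: (Z w \in G i) => /=; ring.
apply: filterS (condE0_eq0 mL mg cg) => w.
rewrite /g /Dm /cm => + tw; rewrite tw !mul1r => gw.
by rewrite -[RHS]gw.
Qed.

(** There is one exceptional set for each pair of an index and a truncation level. As [I] is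
    countable, their union is null and a single null set serves all [i], as the pi-system argument
    at a fixed l requires. *)
Lemma kernel_equation : {ae P, forall w, forall i,
  h false (L w) * kT i (L w) + (h true (L w) - h false (L w)) * k1 i (L w) = 0}.
Proof.
have H : {ae P, forall w, forall n : nat,
    match unpickle n : option (I * nat) with
    | Some im => truncated im.2 (L w) -> h false (L w) * kT im.1 (L w) +
        (h true (L w) - h false (L w)) * k1 im.1 (L w) = 0
    | None => True
    end}.
  apply: ae_foralln => n; case: unpickle => [[i m]|]; last exact: nearW.
  exact: kernel_equation_truncated.
apply: filterS H => w H i.
(* At a given outcome, a truncation level above both values of [h]. *)
pose m := maxn (Num.bound `|h true (L w)|) (Num.bound `|h false (L w)|).
have /= := H (pickle (i, m)); rewrite pickleK /=; apply.
have bound x n : (Num.bound `|h x (L w)| <= n)%N -> `|h x (L w)| <= n%:R.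
  move=> bn; apply: le_trans (ltW (archi_boundP (normr_ge0 _))) _.
  by rewrite ler_nat.
by rewrite /truncated !bound// leq_max leqnn ?orbT.
Qed.

Lemma structural_unique x : {ae P, forall w, h x (L w) = 0}.
Proof.
apply: filterS kernel_equation => w Hw; set l := L w in Hw *.
have kfin B : measurable B -> (fine (k l B))%:E = k l B.
  move=> mB; rewrite fineK// ge0_fin_numE//.
  apply: (@le_lt_trans _ _ 1%E); last exact: ltry.
  by rewrite -(prob_kernel (s := k) l); apply: le_measure => //; rewrite inE.
have [D0|D0] := eqVneq (h true l - h false l) 0.
  (* When the two values of [h] coincide, the equation for the whole space, where [kT] is 1, says
     that they vanish. *)
  have [i Gi] := GT; have := Hw i; rewrite D0 mul0r addr0 /kT Gi setXTT.
  rewrite prob_kernel mulr1 => hf0.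
  by move: D0; rewrite hf0 subr0 => ht0; case: x.
exfalso; apply: (@relevance true _ (LcalL w)).
(* Otherwise the equation can be solved for [k1], with the same ratio to [kT] for all [i]; this
   contradicts relevance at the point [L w]. *)
apply: (indep_proportional GE GI GT (c := - h false l / (h true l - h false l))).
  exact: prob_kernel.
move=> i; have mB1 : measurable (G i `*` [set true]) by exact: measurableX.
have mBT : measurable (G i `*` [set: bool]) by exact: measurableX.
rewrite -(kfin _ mB1) -(kfin _ mBT) -EFinM; congr EFin.
have := Hw i; rewrite -/(k1 i l) -/(kT i l) => /eqP.
rewrite addrC addr_eq0 => /eqP Hi.
by apply: (mulfI D0); rewrite Hi; field.
Qed.

End uniqueness.

(** * The weighted estimand *)

Lemma measurable_inv (R : realType) : measurable_fun setT (@GRing.inv R).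
Proof.
(* The inverse is continuous only away from 0, so the point 0 is split off. *)
rewrite -(setvU [set (0 : R)]); apply/measurable_funU => //; first exact: measurableC.
split; last exact: measurable_fun_set1.
apply: open_continuous_measurable_fun.
  by apply: closed_openC; exact: closed_eq.
by move=> x; rewrite inE/= => /eqP x0; exact: inv_continuous.
Qed.

(** Regressing on [L] the residual, and the residual times the weight, gives E[Y | L] = b0 + b
    E[A | L] and E[Y pi | L] = b0 E[pi | L] + b E[A pi | L]. In the covariance [b0] cancels, leaving
    [covY] = [b] [covA]. *)
Lemma weighted_effect d dZ dL (Omega : measurableType d) (TZ : measurableType dZ)
    (TL : measurableType dL) (R : realType) (P : probability Omega R)
    (calZ : set TZ) (calL : set TL)
    (A : Omega -> bool) (Z : Omega -> TZ) (L : Omega -> TL) (Y : Omega -> R)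
    (b0 b : TL -> R) (pi : TZ -> TL -> R) (covY covA : TL -> R) :
  measurable_fun setT A -> measurable_fun setT Z -> measurable_fun setT L ->
  (forall w, calZ (Z w)) -> (forall w, calL (L w)) ->
  P.-integrable setT (EFin \o Y) ->
  measurable_fun setT b0 -> measurable_fun setT b ->
  P.-integrable setT (EFin \o (b \o L)) ->
  condE0 P (fun w => (Z w, L w)) (fun w => Y w - (b0 (L w) + (A w)%:R * b (L w))) ->
  regular_weight P calZ calL A Z L pi ->
  is_condCov P L Y (fun w => pi (Z w) (L w)) covY ->
  is_condCov P L (fun w => (A w)%:R) (fun w => pi (Z w) (L w)) covA ->
  {ae P, forall w, b (L w) = covY (L w) / covA (L w)}.
Proof.
move=> mA mZ mL ZcalZ LcalL iY mb0 mb ib cY [mpi [M piM] [eps [c [eps0 hc ceps]]]].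
move=> [_ [eY [ep [eYp [hY hp hYp covYE]]]]] hcovA.
have [_ [eA [ep' [eAp [hA hp' hAp covAE]]]]] := hcovA.
have [_ [cA [cp [cAp [hcA hcp hcAp cE]]]]] := hc.
have uniq V0 g g' : is_condE P L V0 g -> is_condE P L V0 g' ->
    {ae P, forall w, g (L w) = g' (L w)}.
  by move=> hg hg'; exact: is_condE_unique mL hg hg' (nearW _ (fun=> erefl)).
pose a w : R := (A w)%:R.
have ma : measurable_fun setT a.
  have mbool : measurable_fun setT (fun x : bool => x%:R : R) by [].
  exact: measurableT_comp mbool mA.
have ba : exists M : R, {ae P, forall w, `|a w| <= M}.
  by exists 1; apply: nearW => w; rewrite /a; case: (A w); rewrite ?normr1 ?normr0.
have mZL : measurable_fun setT (fun w => (Z w, L w)) by exact: measurable_fun_pair.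
have mpiZL : measurable_fun setT (fun w => pi (Z w) (L w)).
  exact: measurableT_comp mpi mZL.
have bpi : exists M : R, {ae P, forall w, `|pi (Z w) (L w)| <= M}.
  by exists M; apply: nearW => w; exact: piM.
have iab : P.-integrable setT (EFin \o (fun w => a w * b (L w))).
  exact: integrable_boundedM ib ma ba.
(* [b0 (L)] is recovered as [Y] minus the residual minus [a * b (L)], all integrable. *)
have ib0 : P.-integrable setT (EFin \o (fun w => b0 (L w))).
  have := integrableBr (integrableBr iY cY.1) iab.
  by congr (integrable _ _ _); apply/funext => w /=; congr EFin; rewrite /a; ring.
have c1 : condE0 P L (fun w => Y w - (b0 (L w) + a w * b (L w))).
  exact: (condE0_comp measurable_snd cY).
have c2 : condE0 P L (fun w => pi (Z w) (L w) * (Y w - (b0 (L w) + a w * b (L w)))).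
  apply: (condE0_comp (X := fun w => (Z w, L w)) (p := snd)) => //.
  apply: (condE0M mZL mpi cY).
  exact: integrable_boundedM cY.1 mpiZL bpi.
have hbA : is_condE P L (fun w => b (L w) * a w) (fun l => b l * eA l).
  apply: is_condE_pullout => //.
  by move: iab; congr (integrable _ _ _); apply/funext => w /=; rewrite mulrC.
have hb0p : is_condE P L (fun w => b0 (L w) * pi (Z w) (L w)) (fun l => b0 l * ep l).
  apply: is_condE_pullout => //.
  have := integrable_boundedM ib0 mpiZL bpi.
  by congr (integrable _ _ _); apply/funext => w /=; rewrite mulrC.
have hbAp : is_condE P L (fun w => b (L w) * (a w * pi (Z w) (L w)))
    (fun l => b l * eAp l).
  apply: is_condE_pullout => //.
  have := integrable_boundedM iab mpiZL bpi.
  by congr (integrable _ _ _); apply/funext => w /=; congr EFin; ring.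
have EY : {ae P, forall w, eY (L w) - (b0 (L w) + b (L w) * eA (L w)) = 0}.
  have [meY _ ieY _] := hY; have [mbA _ ibA _] := hbA.
  have mg : measurable_fun setT (fun l => eY l - (b0 l + b l * eA l)).
    by apply: measurable_funB => //; exact: measurable_funD.
  apply: (condE0_eq0 mL mg).
  have := condE0B mL (condE0D mL c1 (is_condE_condE0 mL hbA)) (is_condE_condE0 mL hY).
  by congr (condE0 _ _ _); apply/funext => w /=; ring.
have EYp : {ae P, forall w,
    eYp (L w) - (b0 (L w) * ep (L w) + b (L w) * eAp (L w)) = 0}.
  have [meYp _ _ _] := hYp; have [mbAp _ _ _] := hbAp; have [mb0p _ _ _] := hb0p.
  have mg : measurable_fun setT (fun l => eYp l - (b0 l * ep l + b l * eAp l)).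
    by apply: measurable_funB => //; exact: measurable_funD.
  apply: (condE0_eq0 mL mg).
  have := condE0B mL (condE0D mL (condE0D mL c2 (is_condE_condE0 mL hbAp))
    (is_condE_condE0 mL hb0p)) (is_condE_condE0 mL hYp).
  by congr (condE0 _ _ _); apply/funext => w /=; ring.
(* Regularity bounds another version [c] of the covariance away from 0; it equals [covA] almost
   surely because each of its three regressions is unique. *)
have covA_neq0 : {ae P, forall w, covA (L w) != 0}.
  near=> w.
  have cw : eps <= `|c (L w)| by near: w.
  rewrite -normr_gt0 (lt_le_trans eps0)// (le_trans cw)//.
  have -> : c (L w) = cAp (L w) - cA (L w) * cp (L w) by near: w.
  have -> : covA (L w) = eAp (L w) - eA (L w) * ep' (L w) by near: w.
  have -> : cA (L w) = eA (L w) by near: w; exact: uniq hcA hA.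
  have -> : cp (L w) = ep' (L w) by near: w; exact: uniq hcp hp'.
  by have -> : cAp (L w) = eAp (L w) by near: w; exact: uniq hcAp hAp.
near=> w.
have /eqP EYw : eY (L w) - (b0 (L w) + b (L w) * eA (L w)) = 0 by near: w.
have /eqP EYpw : eYp (L w) - (b0 (L w) * ep (L w) + b (L w) * eAp (L w)) = 0.
  by near: w.
have A0 : covA (L w) != 0 by near: w.
have covAw : covA (L w) = eAp (L w) - eA (L w) * ep' (L w) by near: w.
have -> : covY (L w) = eYp (L w) - eY (L w) * ep (L w) by near: w.
move: EYw EYpw; rewrite !subr_eq0 => /eqP -> /eqP ->.
have epE : ep (L w) = ep' (L w) by near: w; exact: uniq hp hp'.
apply: (mulIf A0); rewrite divfK// epE covAw; ring.
Unshelve. all: by end_near. Qed.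

(** * Existence, uniqueness and the average effect *)

Unset Implicit Arguments.

Theorem theorem2p3
  (R : realType)
  (d dU : measure_display) (Omega : measurableType d) (TU : measurableType dU)
  (P : probability Omega R)
  (dZ dL : nat) (calZ : set (dZ.-tuple R)) (calL : set (dL.-tuple R))
  (mcalZ : measurable calZ)
  (A : Omega -> bool) (Z : Omega -> dZ.-tuple R) (L : Omega -> dL.-tuple R)
  (U : Omega -> TU) (Y : Omega -> R) (Ya : bool -> Omega -> R)
  (mA : measurable_fun setT A) (mZ : measurable_fun setT Z)
  (mL : measurable_fun setT L) (mU : measurable_fun setT U)
  (mY : measurable_fun setT Y)
  (ZcalZ : forall w, calZ (Z w)) (LcalL : forall w, calL (L w))
  (Ya_int : forall a, P.-integrable setT (EFin \o Ya a))
  (k : R.-pker (dL.-tuple R) ~> (dZ.-tuple R * bool)%type)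
  (k_law : is_cond_law P L (fun w => (Z w, A w)) k)
  (k_dom : cond_dominated calL k)
  (consistency : {ae P, forall w, Y w = Ya (A w) w})
  (latent_ignorability : forall a,
     cond_indep P (Ya a) (fun w => (A w, Z w)) (fun w => (U w, L w)))
  (iv_independence : cond_indep P Z U L)
  (relevance : iv_relevance calL k)
  (muA : dZ.-tuple R * (TU * dL.-tuple R) -> R) (mA_UL : TU * dL.-tuple R -> R)
  (muAP : is_condE P (fun w => (Z w, (U w, L w))) (fun w => (A w)%:R) muA)
  (mA_ULP : is_condE P (fun w => (U w, L w)) (fun w => (A w)%:R) mA_UL)
  (uncorrelated : forall z, calZ z ->
     is_condCov P L (Ya true \- Ya false)
       (fun w => muA (z, (U w, L w)) - mA_UL (U w, L w)) (cst 0))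
  (delta : TU * dL.-tuple R -> R) (cov : dL.-tuple R -> R)
  (e : bool -> dL.-tuple R -> R)
  (deltaP : is_condE P (fun w => (U w, L w)) (Ya true \- Ya false) delta)
  (covP : is_condCov P L (fun w => delta (U w, L w))
            (fun w => mA_UL (U w, L w)) cov)
  (eP : forall a, is_condE P L (Ya a) (e a)) :
  let fo := fun a l => cov l + e a l in
  [/\ solves P A Z L Y fo,
      forall f, solves P A Z L Y f ->
        forall a, {ae P, forall w, f a (L w) = fo a (L w)} &
      forall (pi : dZ.-tuple R -> dL.-tuple R -> R) (covY covA : dL.-tuple R -> R),
        regular_weight P calZ calL A Z L pi ->
        is_condCov P L Y (fun w => pi (Z w) (L w)) covY ->
        is_condCov P L (fun w => (A w)%:R) (fun w => pi (Z w) (L w)) covA ->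
        ('E_P[Ya true \- Ya false] = 'E_P[fun w => (covY (L w) / covA (L w))%R])%E].
Proof.
move=> fo.
have mZL : measurable_fun setT (fun w => (Z w, L w)) by exact: measurable_fun_pair.
have mbool : measurable_fun setT (fun x : bool => x%:R : R) by [].
have ma : measurable_fun setT (fun w => (A w)%:R : R).
  exact: measurableT_comp mbool mA.
have ba : exists M : R, {ae P, forall w, `|(A w)%:R| <= M}.
  by exists 1; apply: nearW => w; case: (A w); rewrite ?normr1 ?normr0.
have [mcov _] := covP.
have me a : measurable_fun setT (e a) by case: (eP a).
have mfo a : measurable_fun setT (fo a) by exact: measurable_funD.
(* As the treatment is binary, fo(A, L) = b0(L) + A b(L). *)
pose b l := e true l - e false l; pose b0 l := cov l + e false l.
have mb : measurable_fun setT b by exact: measurable_funB.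
have mb0 : measurable_fun setT b0 by exact: measurable_funD.
have ib : P.-integrable setT (EFin \o (b \o L)).
  by apply: integrableBr; [case: (eP true)|case: (eP false)].
have bP : is_condE P L (Ya true \- Ya false) b.
  apply: condE0_is_condE => //.
  have := condE0B mL (is_condE_condE0 mL (eP true)) (is_condE_condE0 mL (eP false)).
  by congr (condE0 _ _ _); apply/funext => w; rewrite /b/=; ring.
have iY : P.-integrable setT (EFin \o Y).
  have [_ iD _ _] := bP.
  (* Y = Y(0) + A (Y(1) - Y(0)) almost surely, by consistency. *)
  have iU := integrableDr (Ya_int false) (integrable_boundedM iD ma ba).
  apply: (integrable_ae_eq iU) => //.
  by apply: filterS consistency => w ->; case: (A w) => /=; ring.
have cS : condE0 P (fun w => (Z w, L w)) (fun w => Y w - fo (A w) (L w)).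
  exact: (structural_equation mcalZ mA mZ mL mU mY ZcalZ LcalL Ya_int k_law k_dom
    consistency latent_ignorability iv_independence muAP mA_ULP uncorrelated
    deltaP covP eP).
have [g hg] := is_condE_exists mZL iY.
split.
- split=> //; exists g; split=> //; have [mg _ ig _] := hg.
  apply: condE0_is_condE => //.
  have := condE0B mZL (is_condE_condE0 mZL hg) cS.
  by congr (condE0 _ _ _); apply/funext => w; ring.
- move=> f [mf [g' [hY hf]]] a.
  pose h x l := f x l - fo x l.
  have mh x : measurable_fun setT (h x) by exact: measurable_funB.
  have ch : condE0 P (fun w => (Z w, L w)) (fun w => h (A w) (L w)).
    (* The residuals of [Y] and of [f] share the regression [g'], which cancels along with [Y]. *)
    have := condE0B mZL cS (condE0B mZL (is_condE_condE0 mZL hY)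
      (is_condE_condE0 mZL hf)).
    by congr (condE0 _ _ _); apply/funext => w; rewrite /h; ring.
  (* The empty list of constraints gives the whole space. *)
  have GT : exists s, @rational_orthant R dZ s = setT.
    by exists [::]; apply/seteqP; split.
  have GI : setI_closed (range (@rational_orthant R dZ)).
    move=> _ _ [s1 _ <-] [s2 _ <-]; exists (s1 ++ s2) => //.
    by rewrite setI_rational_orthant.
  have hu : {ae P, forall w, h a (L w) = 0}.
    exact: (structural_unique mA mZ mL LcalL k_law relevance
      (measurable_tuple_generated R dZ) GI GT mh ch).
  by apply: filterS hu => w /eqP; rewrite subr_eq0 => /eqP.
- move=> pi covY covA hpi hcovY hcovA.
  have cS' : condE0 P (fun w => (Z w, L w))
      (fun w => Y w - (b0 (L w) + (A w)%:R * b (L w))).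
    move: cS; congr (condE0 _ _ _); apply/funext => w.
    by rewrite /fo /b0 /b; case: (A w) => /=; ring.
  have bE := weighted_effect mA mZ mL ZcalZ LcalL iY mb0 mb ib cS' hpi hcovY hcovA.
  rewrite unlock (is_condE_integral bP); apply: ae_eq_integral => //.
  + by apply/measurable_EFinP; exact: measurableT_comp.
  + have [mcY _] := hcovY; have [mcA _] := hcovA.
    apply/measurable_EFinP/measurable_funM; first exact: measurableT_comp mcY mL.
    have mcAL : measurable_fun setT (covA \o L) by exact: measurableT_comp.
    exact: measurableT_comp (@measurable_inv R) mcAL.
  + by apply: filterS bE => w ->.
Qed.
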